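(* Let $\Gamma$ be a countable amenable group with a fixed Følner sequence $\{F_n\}_{n\ge1}$. Let $\Gamma\curvearrowright Y$ be a dynamical system and $\Gamma\curvearrowright G$ an algebraic action. Suppose that $\sigma\colon\Gamma\times Y\to G$ is a continuous cocycle. Then for the induced $G$-extension $\Gamma\curvearrowright Y\times_\sigma G$, with factor map $\pi\colon Y\times_\sigma G\to Y$ the projection, we have $$\operatorname{mdim}(Y\times_\sigma G)\le\operatorname{mdim}(Y)+\sup_{y\in Y}\operatorname{mdim}(\pi^{-1}(y),\Gamma).$$
   Context: $\Gamma$ is a countable amenable group and $\mathcal F(\Gamma)$ is the set of nonempty finite subsets of $\Gamma$. For $K\in\mathcal F(\Gamma)$ and $\delta>0$, $\mathcal B(K,\delta)$ is the set of $F\in\mathcal F(\Gamma)$ with $|\{t\in F: Kt\subseteq F\}|\ge(1-\delta)|F|$. For a real-valued $\varphi$ on $\mathcal F(\Gamma)$, $\lim_F\varphi(F)=c$ means: for every $\varepsilon>0$ there are $K\in\mathcal F(\Gamma)$, $\delta>0$ with $|\varphi(F)-c|<\varepsilon$ for all $F\in\mathcal B(K,\delta)$. A Følner sequence is a sequence $\{F_n\}_{n\ge1}$ in $\mathcal F(\Gamma)$ with $|sF_n\Delta F_n|/|F_n|\to0$ for every $s\in\Gamma$. A dynamical system $\Gamma\curvearrowright X$ is a (nonempty) compact metrizable space $X$ with a continuous action of $\Gamma$. It is an algebraic action if $X$ is a compact metrizable group and $\Gamma$ acts by continuous automorphisms. A continuous cocycle is a continuous map $\sigma\colon\Gamma\times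 Y\to G$ with $\sigma(st,y)=\sigma(s,ty)\cdot s(\sigma(t,y))$ for all $s,t\in\Gamma$, $y\in Y$. $Y\times_\sigma G$ denotes the space $Y\times G$ with the $\Gamma$-action $s(y,g)=(sy,\sigma(s,y)\cdot(sg))$. For a finite open cover $\mathcal U$ of a space $X$, $\operatorname{ord}(\mathcal U)=\max_{x\in X}\sum_{U\in\mathcal U}1_U(x)-1$; $\mathcal U$ refines $\mathcal V$ if every element of $\mathcal U$ is contained in some element of $\mathcal V$; $\mathcal D(\mathcal U)$ is the minimum of $\operatorname{ord}(\mathcal W)$ over all finite open covers $\mathcal W$ of the space refining $\mathcal U$. For a dynamical system and $F\in\mathcal F(\Gamma)$, $\mathcal U^F=\bigvee_{s\in F}s^{-1}\mathcal U$, where $\mathcal U\vee\mathcal V=\{U\cap V:U\in\mathcal U,V\in\mathcal V\}$. The mean dimension is $\operatorname{mdim}(X)=\sup_{\mathcal U}\lim_F\mathcal D(\mathcal U^F)/|F|\in[0,\infty]$ over all finite open covers $\mathcal U$ of $X$ (the limit exists). For a closed subset $K\subseteq X$ of a dynamical system $\Gamma\curvearrowright X$ (here $X=Y\times_\sigma G$), $\mathcal U|_K=\{U\cap K:U\in\mathcal U\}$ is the induced open cover of $K$, and $$\operatorname{mdim}(K,\Gamma)=\sup_{\mathcal U}\liminf_{n\to\infty}\frac{\mathcal D(\mathcal U^{F_n}|_K)}{|F_n|},$$ where $\mathcal U$ ranges over all finite open covers of $X$. *)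

(* Defs.v *)
From HB Require Import structures.
From mathcomp Require Import all_boot all_order all_algebra finmap.
From mathcomp Require Import all_classical all_reals all_analysis.

Set Implicit Arguments.
Unset Strict Implicit.
Unset Printing Implicit Defensive.

Import Order.TTheory GRing.Theory Num.Theory.
Import numFieldNormedType.Exports.

Local Open Scope classical_set_scope.
Local Open Scope ring_scope.

HB.mixin Record isTopologicalGroup G of Group G & Topological G := {
  mulg_continuous : continuous (fun p : G * G => (p.1 * p.2)%g) ;
  invg_continuous : continuous (fun x : G => (x^-1)%g)
}.

(* Written multiplicatively, not assumed commutative, no separation axiom. *)
#[short(type="topologicalGroupType")]
HB.structure Definition TopologicalGroup :=
  { G of isTopologicalGroup G & Group G & Topological G }.

Section folner.
Context {R : realType} {Gamma : groupType}.
Implicit Types (K F : {fset Gamma}) (delta : R).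

(* The set B(K, delta). *)
Definition almost_invariant K delta : set {fset Gamma} :=
  [set F | F != fset0 /\
    (1 - delta) * #|` F|%:R <=
      #|` [fset t in F | [fset (s * t)%g | s in K] `<=` F]|%:R]%fset.

(* [phi F @[F --> folner_filter R Gamma] --> c] unfolds to: every neighborhood
   of c contains phi F for all F in some B(K, delta). *)
Definition folner_filter : set_system {fset Gamma} :=
  filter_from [set p : {fset Gamma} * R | p.1 != fset0 /\ 0 < p.2]
              (fun p => almost_invariant p.1 p.2).

(* Amenability in the form of the Folner condition. *)
Definition amenable : Prop :=
  forall K delta, K != fset0 -> 0 < delta -> almost_invariant K delta !=set0.

Definition symdiff K F : {fset Gamma} := ((K `\` F) `|` (F `\` K))%fset.

Definition folner_sequence (F : nat -> {fset Gamma}) : Prop :=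
  (forall n, F n != fset0) /\
  forall s : Gamma,
    (#|` symdiff [fset (s * t)%g | t in F n]%fset (F n)|%:R / #|` F n|%:R : R)
      @[n --> \oo] --> (0 : R).

End folner.
Arguments folner_filter R Gamma : clear implicits.
Arguments amenable R Gamma : clear implicits.
Arguments folner_sequence R {Gamma} F.

Definition metrizable (R : realType) (X : topologicalType) : Prop :=
  exists d : X -> X -> R,
    [/\ forall x y, 0 <= d x y,
        forall x y, d x y = 0 <-> x = y,
        forall x y, d x y = d y x,
        forall x y z, d x z <= d x y + d y z &
        forall (x : X) (A : set X),
          nbhs x A <-> exists2 e : R, 0 < e & [set y | d x y < e] `<=` A].

Section actions.
Context (R : realType) {Gamma : groupType}.

Definition is_action (X : Type) (a : Gamma -> X -> X) : Prop :=
  (forall x, a 1%g x = x) /\ (forall s t x, a (s * t)%g x = a s (a t x)).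

(* The acting group carries the discrete topology. *)
Definition dynamical_system (X : topologicalType) (a : Gamma -> X -> X) :=
  [/\ [set: X] !=set0, compact [set: X], metrizable R X, is_action a &
      continuous (fun p : discrete_topology Gamma * X => a p.1 p.2)].

Definition algebraic_action (G : topologicalGroupType) (b : Gamma -> G -> G) :=
  dynamical_system b /\
  forall s g h, b s (g * h)%g = (b s g * b s h)%g.

Definition continuous_cocycle (Y : topologicalType) (a : Gamma -> Y -> Y)
    (G : topologicalGroupType) (b : Gamma -> G -> G)
    (sigma : Gamma -> Y -> G) : Prop :=
  continuous (fun p : discrete_topology Gamma * Y => sigma p.1 p.2) /\
  forall s t y,
    sigma (s * t)%g y = (sigma s (a t y) * b s (sigma t y))%g.

(* The action on the skew product of Y and G along sigma. *)
Definition skew_action (Y : topologicalType) (a : Gamma -> Y -> Y)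
    (G : topologicalGroupType) (b : Gamma -> G -> G)
    (sigma : Gamma -> Y -> G) : Gamma -> Y * G -> Y * G :=
  fun s p => (a s p.1, (sigma s p.1 * b s p.2)%g).

End actions.

Section covers.
Context (R : realType).

(* A cover is a set of sets: repetitions are not counted in its order. *)
Definition finite_open_cover (X : topologicalType) (U : set (set X)) : Prop :=
  [/\ finite_set U, forall A, U A -> open A & \bigcup_(A in U) A = [set: X]].

Definition refines (X : Type) (U V : set (set X)) : Prop :=
  forall A, U A -> exists2 B, V B & A `<=` B.

(* On a nonempty space, the real supremum (resp. infimum) below is that of a
   nonempty finite (resp. nonempty, bounded below) set of integers: it is a
   maximum (resp. minimum). *)
Definition cover_ord (X : Type) (U : set (set X)) : R :=
  sup (range (fun x : X => \sum_(A \in U) (\1_A x : R))) - 1.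

Definition cover_dim (X : topologicalType) (U : set (set X)) : R :=
  inf [set cover_ord W | W in [set W | finite_open_cover W /\ refines W U]].

Definition cover_join (X : Type) (U V : set (set X)) : set (set X) :=
  [set A `&` B | A in U & B in V].

Definition cover_pull (Gamma : groupType) (X : Type) (a : Gamma -> X -> X)
    (U : set (set X)) (F : {fset Gamma}) : set (set X) :=
  \big[@cover_join X/[set setT]]_(s <- F) [set a s @^-1` A | A in U].

(* The cover induced on K, as a cover of the topological space [set_type K]. *)
Definition cover_restr (X : Type) (U : set (set X)) (K : set X) : set (set K) :=
  [set (@set_val X K) @^-1` A | A in U].

End covers.
Arguments cover_restr {X} U K.

Section mean_dimension.
Context (R : realType) (Gamma : groupType) (X : topologicalType).
Variable a : Gamma -> X -> X.

Definition mdim : \bar R :=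
  ereal_sup
    [set (lim (cover_dim R (cover_pull a U F) / #|` F|%:R
                @[F --> folner_filter R Gamma]))%:E
    | U in @finite_open_cover X].

Definition mdim_on (F : nat -> {fset Gamma}) (K : set X) : \bar R :=
  ereal_sup
    [set limn_einf (fun n =>
       (cover_dim R (cover_restr (cover_pull a U (F n)) K) / #|` F n|%:R)%:E)
    | U in @finite_open_cover X].

End mean_dimension.

(* Main.v *)
(** Write X for the skew product. Quasi-tilings (Ornstein-Weiss) reduce the
    covers U^A, with A very invariant, to translates Tc of finitely many tiles T
    taken from the Folner sequence. Over a single tile the cocycle
    varies little on the elements of some cover V of Y depending on the tiles
    only, while the G-coordinate need only be known up to a cover W of G chosen
    before the tiles, because W can be made fine for all translates by elements
    of G at once. Reading off the G-coordinate afresh at every tile, U^A is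
    refined by the join of V^A, of one pullback of W^T for each tile, and of a
    small remainder. Subadditivity of the cover dimension D then gives
    D(U^A) <= D(V^A) + sum_(T, c) D(W^T) + small. Along the Folner sequence,
    D(W^T)/|T| is controlled by a single fibre, which is a copy of G on which the
    cocycle acts by left translations. *)

Require Import Defs.
From mathcomp Require Import all_boot all_order all_algebra finmap.
From mathcomp Require Import all_classical all_reals all_analysis.
From mathcomp Require Import ring lra.

Set Implicit Arguments.
Unset Strict Implicit.
Unset Printing Implicit Defensive.

Import Order.TTheory GRing.Theory Num.Theory.
Import numFieldNormedType.Exports.

Local Open Scope classical_set_scope.
Local Open Scope ring_scope.

(** * Translates of a finite set *)

Section Tilings.
Context {Gamma : groupType}.
Implicit Types (K T A M C F : {fset Gamma}) (c s t : Gamma).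

Definition translate T c : {fset Gamma} := [fset (t * c)%g | t in T]%fset.

Definition translates T C : {fset Gamma} := (\bigcup_(c <- C) translate T c)%fset.

(** The set counted in [almost_invariant]: F lies in B(K, delta) when its core has proportion at
    least 1 - delta. *)
Definition core K F : {fset Gamma} := [fset t in F | translate K t `<=` F]%fset.

Lemma translateP T c x :
  reflect (exists2 t, t \in T & x = (t * c)%g) (x \in translate T c).
Proof. by apply: (iffP (imfsetP _ _ _ _)) => -[t]; exists t. Qed.

Lemma mem_translate T c t : t \in T -> (t * c)%g \in translate T c.
Proof. by move=> tT; apply/translateP; exists t. Qed.

Lemma card_translate T c : #|` translate T c| = #|` T|.
Proof. by rewrite card_imfset //; exact: mulIg. Qed.

Lemma translatesP T C x :
  reflect (exists c t, [/\ c \in C, t \in T & x = (t * c)%g])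
          (x \in translates T C).
Proof.
apply: (iffP (bigfcupP _ _ _ _)).
- by case=> c /andP[cC _] /translateP[t tT ->]; exists c, t.
- by case=> c [t [cC tT ->]]; exists c; rewrite ?cC //; exact: mem_translate.
Qed.

Lemma core_sub K F : (core K F `<=` F)%fset.
Proof. exact: fset_sub. Qed.

Lemma card_fset_sep (P : pred Gamma) T :
  #|` [fset t in T | P t]%fset| = (\sum_(t <- T) P t)%N.
Proof.
rewrite card_fset_sum1 big_fset /= big_mkcond /=.
by apply: eq_bigr => t _; case: (P t).
Qed.

(** Double counting: for fixed t the map c -> tc is injective, so each t in T contributes at most
    |M| incidences. *)
Lemma sum_card_translateI T M (I : {fset Gamma}) :
  (\sum_(c <- I) #|` (translate T c `&` M)%fset| <= #|` T| * #|` M|)%N.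
Proof.
have meetE c : (#|` (translate T c `&` M)%fset| <= \sum_(t <- T) ((t * c)%g \in M))%N.
  rewrite -(card_fset_sep (fun t => (t * c)%g \in M)).
  rewrite -[leqRHS](card_translate _ c); apply: fsubset_leq_card; apply/fsubsetP => x.
  rewrite in_fsetI => /andP[/translateP[t tT ->] xM]; apply: mem_translate.
  by rewrite !inE tT.
apply: (leq_trans (leq_sum _ _)); first by move=> c _; exact: meetE.
rewrite exchange_big /= card_fset_sum1 big_distrl /= leq_sum // => t _.
rewrite mul1n.
rewrite -(card_fset_sep (fun c => (t * c)%g \in M)).
set B := [fset c in I | _]%fset.
have <- : #|` [fset (t * c)%g | c in B]%fset| = #|` B|.
  by rewrite card_imfset //; exact: mulgI.
apply: fsubset_leq_card; apply/fsubsetP => x /imfsetP[c /=].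
by rewrite !inE => /andP[_ ?] ->.
Qed.

(** If kc = td with c outside TC, then k^-1 t is not in T, so t lies outside the core of T for K^-1.
    As c = k^-1 t d, counting the triples (k, t, d) bounds the number of such c. *)
Lemma card_boundary_translates K T C A :
  (#|` [fset c in A `\` translates T C |
        ~~ [disjoint translate K c & translates T C]%fset]%fset|
   <= #|` K| * (#|` T| - #|` core [fset (k^-1)%g | k in K]%fset T|) * #|` C|)%N.
Proof.
set E := [fset c in _ | _]%fset.
set B := (T `\` core [fset (k^-1)%g | k in K]%fset T)%fset.
have -> : (#|` T| - #|` core [fset (k^-1)%g | k in K]%fset T| = #|` B|)%N.
  by rewrite cardfsDS // core_sub.
pose s := [seq (p.1^-1 * p.2 * c)%g | p <- [seq (k, t) | k <- K, t <- B], c <- C].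
have -> : (#|` K| * #|` B| * #|` C| = size s)%N by rewrite /s !size_allpairs.
apply: uniq_leq_size => // c.
rewrite !inE /= -fsetI_eq0 => /andP[/andP[cM cA] /fset0Pn[x]].
rewrite in_fsetI => /andP[ /translateP[k kK xE]].
case/translatesP=> d [t [dC tT xE']].
have cE : c = (k^-1 * t * d)%g by rewrite -mulgA -xE' xE mulKg.
rewrite cE; apply/allpairsP; exists ((k, t), d); split => //=.
apply/allpairsP; exists (k, t); split => //=.
rewrite !inE tT andbT /=; apply/negP => /fsubsetP/(_ (k^-1 * t)%g) h.
move: cM; rewrite cE; apply/negP; rewrite negbK; apply/translatesP.
exists d, (k^-1 * t)%g; split => //; apply: h; apply: mem_translate.
by apply/imfsetP; exists k.
Qed.

Context {R : realType}.
Implicit Types (e q delta eta : R).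

(* Maximality of the number of translates replaces a greedy choice: a translate
   that cannot be added meets the union in a proportion at least [e]. *)
Lemma fill T A e : T != fset0 -> 0 < e -> e <= 1 ->
  exists C, [/\ (C `<=` core T A)%fset, (translates T C `<=` A)%fset,
    (1 - e) * (#|` T| * #|` C|)%:R <= #|` translates T C|%:R &
    e * #|` core T A|%:R <= #|` translates T C|%:R].
Proof.
move=> T0 e0 e1; set I := core T A.
pose P n := `[< exists C, [/\ (C `<=` I)%fset,
   (1 - e) * (#|` T| * #|` C|)%:R <= #|` translates T C|%:R & #|` C| = n] >].
have exP : exists n, P n.
  exists 0%N; apply/asboolP; exists fset0.
  by rewrite fsub0set cardfs0 muln0 mulr0.
have ubP n : P n -> (n <= #|` I|)%N.
  by move=> /asboolP[C [CI _ <-]]; exact: fsubset_leq_card.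
have [n /asboolP[C [CI hC Cn]] nmax] := ex_maxnP exP ubP.
exists C; split => //.
  apply/fsubsetP => x /translatesP[c [t [cC tT ->]]].
  have := fsubsetP CI _ cC; rewrite !inE => /andP[_ /fsubsetP]; apply.
  exact: mem_translate.
set M := translates T C.
have big c : c \in I -> e * #|` T|%:R <= #|` (translate T c `&` M)%fset|%:R.
  move=> cI; have [cC|cC] := boolP (c \in C).
    have -> : (translate T c `&` M = translate T c)%fset.
      apply/fsetIidPl/fsubsetP => x /translateP[t tT ->].
      by apply/translatesP; exists c, t.
    by rewrite card_translate ler_piMl.
  rewrite leNgt; apply/negP => lt.
  suff /nmax : P n.+1 by rewrite ltnn.
  apply/asboolP; exists (c |` C)%fset; split.
  - by apply/fsubsetP => x; rewrite in_fset1U => /orP[/eqP->|/(fsubsetP CI)].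
  - have -> : translates T (c |` C)%fset = (translate T c `|` M)%fset.
      apply/fsetP => x; rewrite inE; apply/translatesP/orP.
        case=> d [t [+ tT ->]]; rewrite !inE => /orP[/eqP->|dC].
          by left; exact: mem_translate.
        by right; apply/translatesP; exists d, t.
      case=> [/translateP[t tT ->]|/translatesP[d [t [dC tT ->]]]].
        by exists c, t; rewrite !inE eqxx.
      by exists d, t; rewrite !inE dC orbT.
    have := cardfsUI (translate T c) M; rewrite card_translate.
    move=> /(congr1 (fun n => n%:R : R)); rewrite !natrD => UI.
    rewrite cardfsU1 cC add1n mulnS natrD mulrDr.
    move: hC lt UI; rewrite -/M; lra.
  - by rewrite cardfsU1 cC Cn.
have /(congr1 (fun n => n%:R : R)) : (\sum_(c <- I) #|` T| = #|` T| * #|` I|)%N.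
  by rewrite big_const_seq count_predT iter_addn_0.
rewrite natr_sum natrM => TI.
(* Averaging over all possible centres: summing [big] over the core and double counting leaves a
   common factor |T| to cancel. *)
have : \sum_(c <- I) e * #|` T|%:R <= (#|` T| * #|` M|)%:R.
  apply: (@le_trans _ _ (\sum_(c <- I) #|` (translate T c `&` M)%fset|)%N%:R); last first.
    by rewrite ler_nat sum_card_translateI.
  rewrite natr_sum big_seq [leRHS]big_seq; apply: ler_sum => c; exact: big.
rewrite -mulr_sumr TI natrM mulrCA ler_pM2l // ltr0n cardfs_gt0 //.
Qed.

End Tilings.

(** * Quasi-tilings of almost invariant sets *)

Section QuasiTiling.
Context {R : realType} {Gamma : groupType}.
Implicit Types (K T A M C F : {fset Gamma}) (L : seq ({fset Gamma} * Gamma)).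
Implicit Types (e theta delta r : R).

Definition tiles_union L : {fset Gamma} := (\bigcup_(p <- L) translate p.1 p.2)%fset.

Definition arbitrarily_invariant (TT : set {fset Gamma}) :=
  forall K delta, K != fset0 -> 0 < delta ->
    exists2 T, TT T & almost_invariant K delta T.

Lemma core_subl K K' A : (K `<=` K')%fset -> (core K' A `<=` core K A)%fset.
Proof.
move=> KK'; apply/fsubsetP => c; rewrite !inE => /andP[-> /fsubsetP cA] /=.
apply/fsubsetP => _ /translateP[k kK ->]; apply: cA; apply: mem_translate.
exact: (fsubsetP KK').
Qed.

(** Each round covers a proportion at least e/2 of what is left. The tile used first is chosen last,
    invariant enough with respect to the K and delta of the later rounds that the remainder, unless
    already smaller than theta |A|, is again (K, delta)-invariant. *)
Lemma quasi_tiling_rec (TT : set {fset Gamma}) e theta N :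
  arbitrarily_invariant TT -> 0 < e -> e <= 2^-1 -> 0 < theta ->
  exists (S : seq {fset Gamma}) K delta,
    [/\ forall T, T \in S -> TT T, K != fset0, 0 < delta &
     forall A, almost_invariant K delta A ->
     exists L, [/\ forall p, p \in L -> p.1 \in S /\ p.2 \in A,
       (tiles_union L `<=` A)%fset,
       (1 - e) * (\sum_(p <- L) #|` p.1|)%N%:R <= #|` tiles_union L|%:R &
       #|` (A `\` tiles_union L)%fset|%:R
         <= Num.max theta ((1 - e / 2) ^+ N) * #|` A|%:R]].
Proof.
move=> HTT e0 e12 th0; elim: N => [|N [S [K [delta [ST K0 d0 IH]]]]].
  exists [::], [fset 1%g]%fset, 1; split => //.
    by apply/fset0Pn; exists 1%g; rewrite inE.
  move=> A _; exists [::]; rewrite /tiles_union !big_nil; split => //.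
  - by rewrite mulr0.
  - rewrite fsetD0 expr0 -[leLHS]mul1r ler_wpM2r // le_max lexx orbT //.
pose Ki := [fset (k^-1)%g | k in K]%fset.
have Ki0 : Ki != fset0.
  by have /fset0Pn[k kK] := K0; apply/fset0Pn; exists (k^-1)%g; apply/imfsetP; exists k.
have cK0 : 0 < #|` K|%:R :> R by rewrite ltr0n cardfs_gt0.
(* With |T| |C| <= 2 |A|, the boundary count |K| (eta |T|) |C| is then at most delta theta |A| /
   2. *)
pose eta := delta * theta / (4 * #|` K|%:R).
have eta0 : 0 < eta by rewrite /eta divr_gt0 ?mulr_gt0.
have [T TTT [T0 Tinv]] := HTT Ki eta Ki0 eta0.
(* The bound 1/2 gives T a core of at least half of A; the bound delta theta / 2 is the other half
   of the loss allowed in the invariance of the remainder. *)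
pose delta' := Num.min 2^-1 (delta * theta / 2).
have d'0 : 0 < delta' by rewrite /delta' lt_min; apply/andP; split; rewrite ?divr_gt0 ?mulr_gt0 ?invr_gt0.
exists (T :: S), (K `|` T)%fset, delta'; split => //.
- by move=> T'; rewrite inE => /orP[/eqP->//|/ST].
- by have /fset0Pn[k kK] := K0; apply/fset0Pn; exists k; rewrite inE kK.
move=> A [A0 Ainv].
have AinvK : (1 - delta') * #|` A|%:R <= #|` core K A|%:R.
  apply: le_trans Ainv _; rewrite ler_nat; apply: fsubset_leq_card.
  by apply: core_subl; exact: fsubsetUl.
have AinvT : (1 - delta') * #|` A|%:R <= #|` core T A|%:R.
  apply: le_trans Ainv _; rewrite ler_nat; apply: fsubset_leq_card.
  by apply: core_subl; exact: fsubsetUr.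
have e1 : e <= 1 by lra.
have [C [CI MA hC hM]] := fill A T0 e0 e1.
set M := translates T C in MA hC hM *.
pose L0 := [seq (T, c) | c <- C].
have L0U : tiles_union L0 = M by rewrite /tiles_union /L0 big_map.
have L0S : (\sum_(p <- L0) #|` p.1| = #|` T| * #|` C|)%N.
  by rewrite /L0 big_map /= big_const_seq count_predT iter_addn_0.
have L0P p : p \in L0 -> p.1 \in T :: S /\ p.2 \in A.
  move=> /mapP[c cC ->]; rewrite inE eqxx; split => //=.
  exact: (fsubsetP (core_sub T A)) (fsubsetP CI _ cC).
have d'2 : delta' <= 2^-1 by rewrite /delta' ge_min lexx.
have d'dt : delta' <= delta * theta / 2 by rewrite /delta' ge_min lexx orbT.
have cA0 : 0 < #|` A|%:R :> R by rewrite ltr0n cardfs_gt0.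
have Mlarge : e / 2 * #|` A|%:R <= #|` M|%:R :> R.
  apply: le_trans hM; rewrite -mulrA ler_pM2l //; apply: le_trans AinvT.
  by rewrite ler_pM2r //; lra.
set A' := (A `\` M)%fset.
have A'E : #|` A'|%:R = #|` A|%:R - #|` M|%:R :> R.
  by rewrite /A' cardfsDS // natrB // fsubset_leq_card.
have A'q : #|` A'|%:R <= (1 - e / 2) * #|` A|%:R :> R by rewrite A'E; lra.
(* Either the tiling may stop here, or theta |A| < |A'|, so that losses measured against theta |A|
   are also small against |A'|. *)
have [small|large] := leP (#|` A'|%:R : R) (theta * #|` A|%:R).
  exists L0; rewrite L0U L0S; split => //.
  apply: le_trans small _; rewrite ler_pM2r // le_max lexx //.
have A'0 : A' != fset0.
  rewrite -cardfs_gt0 -(ltr0n R); apply: lt_trans large; exact: mulr_gt0.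
have A'inv : almost_invariant K delta A'.
  split => //; set E := [fset c in A' | ~~ [disjoint translate K c & M]%fset]%fset.
  have cE : (#|` E| <= #|` K| * (#|` T| - #|` core Ki T|) * #|` C|)%N.
    exact: card_boundary_translates.
  (* A point c of the remainder can fail to be in its core only because Kc leaves A or because Kc
     meets the part M already covered. *)
  have cov : (A' `<=` core K A' `|` (A `\` core K A) `|` E)%fset.
    apply/fsubsetP => c cA'; have := cA'; rewrite in_fsetD => /andP[cM cA].
    rewrite !in_fsetU in_fsetD cA andbT.
    have [cE'|cnE] := boolP (c \in E); first by apply/orP; right.
    have [cK|cK] := boolP (c \in core K A); last by apply/orP; left; apply/orP; right.
    apply/orP; left; apply/orP; left; move: cnE; rewrite !inE /= cM cA /= negbK.
    move=> /fdisjointP dis; move: cK; rewrite !inE => /andP[_ /fsubsetP cK].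
    by apply/fsubsetP => x xK; rewrite in_fsetD (dis _ xK) cK.
  have : (#|` A'| <= #|` core K A'| + (#|` A| - #|` core K A|) + #|` E|)%N.
    apply: leq_trans (fsubset_leq_card cov) _.
    apply: leq_trans (leq_card_fsetU _ _).1 _; rewrite leq_add2r.
    apply: leq_trans (leq_card_fsetU _ _).1 _; rewrite leq_add2l.
    by rewrite cardfsDS ?core_sub.
  rewrite -(ler_nat R) !natrD natrB; last by rewrite fsubset_leq_card ?core_sub.
  move: cE; rewrite -(ler_nat R) !natrM natrB; last by rewrite fsubset_leq_card ?core_sub.
  move: Tinv; rewrite -/(core _ _) => Tinv cE cA'.
  have MA' : #|` M|%:R <= #|` A|%:R :> R by rewrite ler_nat fsubset_leq_card.
  have TC : #|` T|%:R * #|` C|%:R <= 2 * #|` A|%:R :> R.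
    have : 2^-1 * (#|` T| * #|` C|)%:R <= #|` A|%:R :> R.
      apply: le_trans MA'; apply: le_trans hC; rewrite ler_wpM2r //; lra.
    by rewrite natrM; lra.
  have : #|` E|%:R <= delta * theta / 2 * #|` A|%:R :> R.
    apply: le_trans cE _.
    apply: (@le_trans _ _ (#|` K|%:R * (eta * #|` T|%:R) * #|` C|%:R)).
      rewrite ler_wpM2r // ler_pM2l //; lra.
    rewrite /eta; have -> : #|` K|%:R * (delta * theta / (4 * #|` K|%:R) * #|` T|%:R)
        * #|` C|%:R = delta * theta / 4 * (#|` T|%:R * #|` C|%:R) :> R.
      by field; rewrite gt_eqF.
    have := ler_wpM2l (_ : 0 <= delta * theta / 4) TC => /(_ _)/le_trans; apply.
      by rewrite divr_ge0 ?mulr_ge0 ?ltW.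
    by rewrite le_eqVlt; apply/orP; left; apply/eqP; field.
  have : delta' * #|` A|%:R <= delta * theta / 2 * #|` A|%:R by rewrite ler_pM2r.
  have : delta * (theta * #|` A|%:R) <= delta * #|` A'|%:R by rewrite ler_pM2l // ltW.
  move: cA' AinvK; rewrite /core; lra.
have [L' [L'P L'A L'S L'q]] := IH A' A'inv.
have LU : tiles_union (L0 ++ L') = (M `|` tiles_union L')%fset.
  by rewrite /tiles_union big_cat /= -/(tiles_union L0) L0U.
have dMM' : (M `&` tiles_union L' = fset0)%fset.
  apply/eqP; rewrite fsetI_eq0; apply/fdisjointP => x xM; apply/negP.
  by move=> /(fsubsetP L'A); rewrite in_fsetD xM.
have A'A : (A' `<=` A)%fset by exact: fsubsetDl.
exists (L0 ++ L'); rewrite LU; split.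
- move=> p; rewrite mem_cat => /orP[/L0P//|/L'P[pS pA']]; rewrite inE pS orbT; split => //.
  exact: (fsubsetP A'A).
- by rewrite fsubUset MA (fsubset_trans L'A).
- have := cardfsUI M (tiles_union L'); rewrite dMM' cardfs0 addn0 => ->.
  rewrite big_cat /= !natrD mulrDr L0S; exact: lerD.
- have -> : (A `\` (M `|` tiles_union L') = A' `\` tiles_union L')%fset.
    by rewrite fsetDUr fsetDDl fsetDUr.
  apply: le_trans L'q _; rewrite maxr_pMl //.
  rewrite maxr_pMl // ge_max !le_max; apply/andP; split; apply/orP; [left|right].
    by rewrite ler_pM2l // ler_nat fsubset_leq_card.
  rewrite exprSr -mulrA; apply: ler_wpM2l => //; apply: exprn_ge0; lra.
Qed.

Lemma quasi_tiling (TT : set {fset Gamma}) e theta :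
  arbitrarily_invariant TT -> 0 < e -> e <= 2^-1 -> 0 < theta ->
  exists (S : seq {fset Gamma}) K delta,
    [/\ forall T, T \in S -> TT T, K != fset0, 0 < delta &
     forall A, almost_invariant K delta A ->
     exists L, [/\ forall p, p \in L -> p.1 \in S /\ p.2 \in A,
       (tiles_union L `<=` A)%fset,
       (1 - e) * (\sum_(p <- L) #|` p.1|)%N%:R <= #|` tiles_union L|%:R &
       #|` (A `\` tiles_union L)%fset|%:R <= theta * #|` A|%:R]].
Proof.
move=> HTT e0 e12 th0.
have [N hN] : exists N, (1 - e / 2) ^+ N <= theta.
  have : (1 - e / 2) ^+ n @[n --> \oo] --> 0 by apply: cvg_expr; rewrite ger0_norm; lra.
  move=> /cvgr0Pnorm_le/(_ theta th0)[N _ /(_ N (leqnn N)) h].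
  by exists N; apply: le_trans h; rewrite ler_norm.
have [S [K [delta [ST K0 d0 IH]]]] := quasi_tiling_rec N HTT e0 e12 th0.
exists S, K, delta; split => // A /IH [L [? ? ? h]]; exists L; split => //.
by apply: le_trans h _; rewrite ler_wpM2r // ge_max lexx.
Qed.

(** Overlaps make the total size of the tiles exceed |A| by a factor at most 1/(1 - e'), and each
    uncovered point costs [c0]. Taking e' small against r and theta small against [c0], each of the
    two errors is at most e/2 per point of A. *)
Lemma quasi_tiling_bound (TT : set {fset Gamma}) (psi : {fset Gamma} -> nat)
    r (c0 : nat) e :
  arbitrarily_invariant TT -> 0 <= r ->
  (forall T, TT T -> (psi T)%:R <= r * #|` T|%:R) -> 0 < e ->
  exists (S : seq {fset Gamma}) K delta,
    [/\ forall T, T \in S -> TT T, K != fset0, 0 < delta &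
     forall A, almost_invariant K delta A ->
     exists L, [/\ forall p, p \in L -> p.1 \in S /\ p.2 \in A,
       (tiles_union L `<=` A)%fset &
       (\sum_(p <- L) psi p.1 + #|` (A `\` tiles_union L)%fset| * c0)%N%:R
         <= (r + e) * #|` A|%:R]].
Proof.
move=> HTT r0 psir e0.
(* Adding 1 keeps the denominators positive when r or [c0] vanishes. *)
pose e' := Num.min 2^-1 (e / (4 * (r + 1))); pose theta := e / (2 * (c0%:R + 1)).
have r1 : 0 < r + 1 by lra.
have c1 : 0 < c0%:R + 1 :> R by rewrite ltr_wpDl.
have e'0 : 0 < e' by rewrite /e' lt_min invr_gt0 ltr0n divr_gt0 ?mulr_gt0.
have e'2 : e' <= 2^-1 by rewrite /e' ge_min lexx.
have th0 : 0 < theta by rewrite /theta divr_gt0 ?mulr_gt0.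
have [S [K [delta [ST K0 d0 IH]]]] := quasi_tiling HTT e'0 e'2 th0.
exists S, K, delta; split => // A /[dup] [[A0 _]] /IH [L [Lp LA LS Lq]].
exists L; split => //.
set s := (\sum_(p <- L) #|` p.1|)%N%:R in LS.
have h1 : (\sum_(p <- L) psi p.1)%N%:R <= r * s.
  rewrite /s !natr_sum mulr_sumr big_seq [leRHS]big_seq; apply: ler_sum => p pL.
  by apply: psir; apply: ST; case: (Lp p pL).
have h2 : theta * c0%:R <= e / 2.
  rewrite /theta mulrAC ler_pdivrMr ?mulr_gt0 // (_ : e / 2 * _ = e * (c0%:R + 1)); last by field.
  by rewrite ler_pM2l // lerDl.
have h3 : r * e' <= e / 4.
  apply: (@le_trans _ _ ((r + 1) * (e / (4 * (r + 1))))).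
    apply: ler_pM => //; [exact: ltW|lra|by rewrite /e' ge_min lexx orbT].
  by rewrite le_eqVlt; apply/orP; left; apply/eqP; field; rewrite gt_eqF.
have MA : #|` tiles_union L|%:R <= #|` A|%:R :> R by rewrite ler_nat fsubset_leq_card.
have A0' : 0 < #|` A|%:R :> R by rewrite ltr0n cardfs_gt0.
have s0 : 0 <= s by [].
have sA : s <= 2 * #|` A|%:R.
  have : 2^-1 * s <= (1 - e') * s by rewrite ler_wpM2r //; lra.
  lra.
have h4 : r * s <= (r + e / 2) * #|` A|%:R.
  have : r * ((1 - e') * s) <= r * #|` A|%:R by rewrite ler_wpM2l // (le_trans LS).
  have : r * e' * s <= e / 4 * (2 * #|` A|%:R) by apply: ler_pM => //; rewrite mulr_ge0 // ltW.
  lra.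
have h5 : #|` (A `\` tiles_union L)%fset|%:R * c0%:R <= e / 2 * #|` A|%:R.
  apply: (@le_trans _ _ (theta * #|` A|%:R * c0%:R)); first by rewrite ler_wpM2r.
  by rewrite mulrAC ler_pM2r.
by rewrite natrD natrM; lra.
Qed.

End QuasiTiling.
Arguments arbitrarily_invariant R {Gamma} TT.

(** * Limits along the Folner filter *)

Section FolnerLimits.
Context {R : realType} {Gamma : groupType}.
Implicit Types (K T A F : {fset Gamma}) (L : seq ({fset Gamma} * Gamma)).
Implicit Types (e delta r : R).

Lemma almost_invariantS K K' delta delta' A : (K `<=` K')%fset ->
  delta' <= delta -> almost_invariant K' delta' A -> almost_invariant K delta A.
Proof.
move=> KK' dd [A0 hA]; split => //.
apply: (@le_trans _ _ ((1 - delta') * #|` A|%:R)); first by rewrite ler_wpM2r // lerB.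
by apply: le_trans hA _; rewrite ler_nat; apply: fsubset_leq_card; exact: core_subl.
Qed.

Global Instance folner_filter_filter : Filter (folner_filter R Gamma).
Proof.
apply: filter_from_filter.
  by exists ([fset 1%g]%fset, 1); split => //; apply/fset0Pn; exists 1%g; rewrite inE.
move=> [K d] [K' d'] [/= K0 d0] [/= K'0 d'0].
exists ((K `|` K')%fset, Num.min d d'); first split => /=.
- by have /fset0Pn[k kK] := K0; apply/fset0Pn; exists k; rewrite inE kK.
- by rewrite lt_min d0.
move=> A /= hA; split; apply: almost_invariantS hA.
- exact: fsubsetUl.
- by rewrite ge_min lexx.
- exact: fsubsetUr.
- by rewrite ge_min lexx orbT.
Qed.

Lemma folner_filter_proper : amenable R Gamma -> ProperFilter (folner_filter R Gamma).
Proof.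
by move=> ham; apply: filter_from_proper => -[K d] [/= K0 d0]; exact: ham.
Qed.

(** A point t of F_n outside the core has st outside F_n for some s in K, so st lies in the
    symmetric difference of sF_n and F_n. Summing over the finite set K bounds the number of such
    t. *)
Lemma folner_sequence_almost_invariant (F : nat -> {fset Gamma}) K delta :
  folner_sequence R F -> 0 < delta ->
  \forall n \near \oo, almost_invariant K delta (F n).
Proof.
move=> [F0 hF] d0.
pose eta := delta / (#|` K|%:R + 1).
have K1 : 0 < #|` K|%:R + 1 :> R by rewrite ltr_wpDl.
have eta0 : 0 < eta by rewrite divr_gt0.
have near_all : \forall n \near \oo, forall s, s \in enum_fset K ->
    #|` symdiff [fset (s * t)%g | t in F n]%fset (F n)|%:R <= eta * #|` F n|%:R.
  elim: (enum_fset K) => [|s k IH]; first by apply: nearW => n s; rewrite in_nil.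
  have /cvgr0Pnorm_le/(_ eta eta0) h := hF s.
  near=> n => s'; rewrite inE => /orP[/eqP->|s'k].
    have : `|#|` symdiff [fset (s * t)%g | t in F n]%fset (F n)|%:R / #|` F n|%:R| <= eta.
      by near: n.
    by rewrite ger0_norm ?divr_ge0 // ler_pdivrMr // ltr0n cardfs_gt0.
  by move: s' s'k; near: n.
near=> n; split; first exact: F0.
have hn : forall s, s \in enum_fset K ->
    #|` symdiff [fset (s * t)%g | t in F n]%fset (F n)|%:R <= eta * #|` F n|%:R.
  by near: n.
rewrite -/(core K (F n)).
have cov : (F n `<=` core K (F n) `|`
    \bigcup_(s <- K) [fset t in F n | (s * t)%g \notin F n])%fset.
  apply/fsubsetP => t tF; rewrite in_fsetU.
  have [//|tc] := boolP (t \in core K (F n)).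
  apply/bigfcupP; move: tc; rewrite !inE tF /= => /fsubsetPn[_ /translateP[s sK ->] stF].
  by exists s; rewrite ?sK // !inE tF.
have card1 s : (#|` [fset t in F n | (s * t)%g \notin F n]|
    <= #|` symdiff [fset (s * t)%g | t in F n] (F n)|)%N%fset.
  set B := [fset t in F n | _]%fset.
  have <- : #|` [fset (s * t)%g | t in B]%fset| = #|` B|.
    by rewrite card_imfset //; exact: mulgI.
  apply: fsubset_leq_card; apply/fsubsetP => _ /imfsetP[t /= + ->].
  rewrite !inE => /andP[tF stF]; apply/orP; left; rewrite stF.
  by apply/imfsetP; exists t.
have : (#|` F n| <= #|` core K (F n)| +
    \sum_(s <- K) #|` symdiff [fset (s * t)%g | t in F n]%fset (F n)|)%N.
  apply: leq_trans (fsubset_leq_card cov) _.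
  apply: leq_trans (leq_card_fsetU _ _).1 _; rewrite leq_add2l.
  apply: (@leq_trans (\sum_(s <- K) #|` [fset t in F n | (s * t)%g \notin F n]%fset|)).
    elim/big_ind2 : _ => [|A a B b Aa Bb|//]; first by rewrite cardfs0.
    by apply: leq_trans (leq_card_fsetU _ _).1 _; exact: leq_add.
  by apply: leq_sum => s _; exact: card1.
rewrite -(ler_nat R) natrD natr_sum.
have : \sum_(s <- K) #|` symdiff [fset (s * t)%g | t in F n]%fset (F n)|%:R
     <= \sum_(s <- K) eta * #|` F n|%:R.
  by rewrite big_seq [leRHS]big_seq; apply: ler_sum => s; exact: hn.
have : \sum_(s <- K) eta * #|` F n|%:R <= delta * #|` F n|%:R.
  rewrite big_const_seq count_predT iter_addr_0 -[leLHS]mulr_natr mulrAC.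
  rewrite ler_wpM2r // /eta mulrAC ler_pdivrMr // ler_pM2l // lerDl //.
lra.
Unshelve. all: by end_near. Qed.

(** * The Ornstein-Weiss limit theorem *)

Section OrnsteinWeiss.
Variable phi : {fset Gamma} -> nat.
Hypothesis phi0 : phi fset0 = 0%N.
Hypothesis phiU : forall A B, (phi (A `|` B)%fset <= phi A + phi B)%N.
Hypothesis phi_translate : forall A c, (phi (translate A c) <= phi A)%N.

Lemma subadditive_tiles L : (phi (tiles_union L) <= \sum_(p <- L) phi p.1)%N.
Proof.
rewrite /tiles_union; elim/big_ind2 : _ => [|A a B b Aa Bb|p _].
- by rewrite phi0.
- by apply: leq_trans (phiU _ _) _; exact: leq_add.
- exact: phi_translate.
Qed.

Lemma subadditive_card A : (phi A <= #|` A| * phi [fset 1%g]%fset)%N.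
Proof.
pose L : seq ({fset Gamma} * Gamma) := [seq ([fset (1%g : Gamma)]%fset, c) | c <- A].
have LA : tiles_union L = A.
  rewrite /tiles_union big_map /=; apply/fsetP => x; apply/bigfcupP/idP.
    by case=> c /andP[cA _] /translateP[t]; rewrite inE => /eqP-> ->; rewrite mul1g.
  move=> xA; exists x; rewrite ?xA //; apply/translateP; exists 1%g.
    by rewrite inE.
  by rewrite mul1g.
rewrite -{1}LA; apply: leq_trans (subadditive_tiles L) _.
by rewrite /L big_map /= big_const_seq count_predT iter_addn_0 mulnC.
Qed.

(** The limit is the infimum of the r >= 0 such that phi(T) <= r |T| for arbitrarily invariant T.
    Quasi-tiling by such T spreads the bound to all sufficiently invariant sets; below the infimum,
    the reverse bound holds on a whole B(K, delta). *)
Lemma ornstein_weiss : amenable R Gamma ->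
  exists2 l : R, 0 <= l &
    (phi F)%:R / #|` F|%:R @[F --> folner_filter R Gamma] --> l.
Proof.
move=> ham; have PF := folner_filter_proper ham.
pose E := [set r : R | 0 <= r /\
  arbitrarily_invariant R [set T | (phi T)%:R <= r * #|` T|%:R]].
have E0 : E !=set0.
  exists (phi [fset 1%g]%fset)%:R; split => // K d K0 d0.
  have [T hT] := ham K d K0 d0; exists T => //=.
  by rewrite -natrM mulnC ler_nat subadditive_card.
have lbE : has_lbound E by exists 0 => r [].
have infE : has_inf E by split.
have l0 : 0 <= inf E by apply: lb_le_inf => // r [].
exists (inf E) => //; apply/cvgrPdist_le => e e0.
have e2 : 0 < e / 2 by rewrite divr_gt0.
have [r [r0 rT] rl] := inf_adherent e2 infE.
have [S [K [d [_ K0 d0 hA]]]] :=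
  quasi_tiling_bound (phi [fset 1%g]%fset) rT r0 (fun T h => h) e2.
have upper : \forall F \near folner_filter R Gamma, (phi F)%:R <= (r + e / 2) * #|` F|%:R.
  exists (K, d) => //= A /hA [L [_ LA hL]]; apply: le_trans hL.
  rewrite ler_nat; have {1}-> : A = (tiles_union L `|` (A `\` tiles_union L))%fset.
    by rewrite -{1}(fsetIidPr LA) fsetID.
  apply: leq_trans (phiU _ _) _; apply: leq_add; first exact: subadditive_tiles.
  exact: subadditive_card.
have lower : \forall F \near folner_filter R Gamma, (inf E - e) * #|` F|%:R <= (phi F)%:R.
  (* Membership in [E] requires r >= 0, so nonpositive candidates are treated apart; for them the
     bound follows from phi >= 0. *)
  have [neg|pos] := leP (inf E - e) 0.
    by apply: nearW => F; apply: le_trans (_ : 0 <= _) => //; rewrite mulr_le0_ge0.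
  have : ~ E (inf E - e) by move=> /(ge_inf lbE); lra.
  move=> /not_andP[/negP|]; first by rewrite -ltNge; lra.
  move=> /existsNP[K' /existsNP[d' /not_implyP[K'0 /not_implyP[d'0 /forall2NP hn]]]].
  exists (K', d') => //= A hA'; case: (hn A) => // /negP.
  by rewrite -ltNge => /ltW.
have nz : \forall F \near folner_filter R Gamma, F != fset0.
  by exists (K, d) => //= A [].
near=> F.
have F0 : 0 < #|` F|%:R :> R by rewrite ltr0n cardfs_gt0; near: F.
have hu : (phi F)%:R / #|` F|%:R <= r + e / 2 by rewrite ler_pdivrMr //; near: F.
have hl : inf E - e <= (phi F)%:R / #|` F|%:R by rewrite ler_pdivlMr //; near: F.
by rewrite ler_norml; apply/andP; split; lra.
Unshelve. all: by end_near. Qed.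

End OrnsteinWeiss.
End FolnerLimits.

(** * Subadditivity of the covering dimension *)

Section Staircase.
Context {R : realType}.
Variables (m p : nat) (u v : nat -> R).
Hypothesis u_homo : {homo u : i j / (i <= j)%N >-> i <= j}.
Hypothesis v_homo : {homo v : i j / (i <= j)%N >-> i <= j}.
Hypotheses (u0 : u 0 = 0) (v0 : v 0 = 0) (uv : u m = v p) (um : 0 < u m).

(** The open intervals between consecutive values of u and of v, numbered i and j, have a common
    point. *)
Definition overlap i j :=
  [&& u i < u i.+1, v j < v j.+1, u i < v j.+1 & v j < u i.+1].

(** Points just to the right of 0 lie in one interval of each family. *)
Lemma overlap_exists : exists (i : 'I_m) (j : 'I_p), overlap i j.
Proof.
have first w q : w 0 = 0 :> R -> 0 < w q ->
    exists i : 'I_q, w i <= 0 /\ 0 < w i.+1.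
  move=> w0 wq; have exk : exists k, 0 < w k by exists q.
  case: (ex_minnP exk) => -[|k]; first by rewrite w0 ltxx.
  move=> wk kmin; have kq : (k < q)%N by exact: kmin.
  exists (Ordinal kq); split => //=; rewrite leNgt; apply/negP => /kmin.
  by rewrite ltnn.
have [i [ui0 ui]] := first u m u0 um.
have vp : 0 < v p by rewrite -uv.
have [j [vj0 vj]] := first v p v0 vp.
by exists i, j; apply/and4P; split; lra.
Qed.

(* An overlapping pair is determined by the first of its two right endpoints;
   the last right endpoint of [v] is never strictly before one of [u]. *)
Lemma card_overlap :
  (#|[set z : 'I_m * 'I_p | overlap z.1 z.2]%SET| <
   #|[set i : 'I_m | (u i < u i.+1)%R]%SET| + #|[set j : 'I_p | (v j < v j.+1)%R]%SET|)%N.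
Proof.
set O := finset _; set A := finset _; set B := finset _.
(* The last nondegenerate interval of v ends at the common total; it is never chosen by the map [g]
   below, whence the strict inequality. *)
have [j0 j0B j0E] : exists2 j0 : 'I_p, j0 \in B & v j0.+1 = v p.
  have exk : exists k, v k == v p by exists p.
  case: (ex_minnP exk) => -[|k /eqP vk kmin].
    by move=> /eqP; rewrite v0 -uv => h; move: um; rewrite -h ltxx.
  have kp : (k < p)%N by apply: kmin.
  exists (Ordinal kp) => //; rewrite inE /= lt_neqAle v_homo // andbT.
  by apply/negP; rewrite vk => /kmin; rewrite ltnn.
pose g (z : 'I_m * 'I_p) : 'I_m + 'I_p :=
  if u z.1.+1 <= v z.2.+1 then inl z.1 else inr z.2.
have ginj : {in O &, injective g}.
  (* A point lies in at most one of the intervals of w' taken open on the left and closed on the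
     right; here the point is a right endpoint of the other family. *)
  have wl (w w' : nat -> R) i j j' : {homo w' : i j / (i <= j)%N >-> i <= j} ->
      w' j < w i -> w' j' < w i -> w i <= w' j.+1 -> w i <= w' j'.+1 -> j = j'.
    move=> w'h h1 h2 h3 h4; have [lt|lt|//] := ltngtP j j'.
      by rewrite leNgt (le_lt_trans (w'h _ _ lt) h2) in h3.
    by rewrite leNgt (le_lt_trans (w'h _ _ lt) h1) in h4.
  move=> [i j] [i' j']; rewrite !inE /= => /and4P[h1 h2 h3 h4] /and4P[k1 k2 k3 k4].
  rewrite /g /=; case: leP => c1; case: leP => c2 // -[E]; subst.
    by congr pair; apply/val_inj; exact: (wl u v i'.+1 _ _ v_homo h4 k4 c1 c2).
  congr pair; apply/val_inj.
  exact: (wl v u j'.+1 _ _ u_homo h3 k3 (ltW c1) (ltW c2)).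
rewrite -(card_in_imset ginj).
have sub : (g @: O \subset (inl @: A) :|: (inr @: (B :\ j0)))%SET.
  apply/fintype.subsetP => _ /imsetP[[i j] + ->]; rewrite inE /= => /and4P[h1 h2 h3 h4].
  rewrite /g /= inE; case: leP => c1; apply/orP; [left|right]; apply: imset_f.
    by rewrite inE.
  rewrite !inE h2 andbT; apply/eqP => jj0; move: c1; rewrite jj0 j0E -uv.
  by rewrite ltNge u_homo.
apply: leq_ltn_trans (subset_leq_card sub) _.
apply: leq_ltn_trans (leq_card_setU _ _).1 _.
rewrite (cardsD1 j0 B) j0B add1n addnS ltnS leq_add //; exact: leq_imset_card.
Qed.

End Staircase.

Section DistanceFunction.
Context {R : realType} {X : topologicalType}.

(** The function is the distance to the complement of A, truncated at 1; it is 1-Lipschitz. *)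
Lemma metrizable_open_fun (A : set X) : metrizable R X -> open A ->
  exists f : X -> R, [/\ continuous f, forall x, 0 <= f x & forall x, 0 < f x <-> A x].
Proof.
move=> [d [d0 deq dC dT dN]] oA.
(* The value 1 keeps this set nonempty when A is the whole space. *)
pose E x := [set r : R | r = 1 \/ exists2 y, ~ A y & r = d x y].
have E1 x : E x 1 by left.
have lbE x : lbound (E x) 0 by move=> r [->//|[y _ ->]].
have hl x : has_lbound (E x) by exists 0.
have hi x : has_inf (E x) by split; [exists 1|].
pose f x := inf (E x).
have f0 x : 0 <= f x by apply: lb_le_inf; [exists 1|exact: lbE].
have f1 x : f x <= 1 by apply: ge_inf.
have fd x y : ~ A y -> f x <= d x y by move=> Ay; apply: ge_inf => //; right; exists y.
have flip x y : f x <= f y + d x y.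
  rewrite -lerBlDr; apply: lb_le_inf; first by exists 1.
  move=> r [->|[z Az ->]].
    by rewrite lerBlDr (le_trans (f1 x)) // lerDl.
  by rewrite lerBlDr addrC (le_trans (fd _ _ Az)).
exists f; split => //.
  move=> x; apply/cvgrPdist_lt => e e0; apply/dN; exists e => // y /= xy.
  rewrite ltr_norml; have := flip x y; have := flip y x; rewrite (dC y x).
  by move=> h1 h2; apply/andP; split; lra.
move=> x; split.
  by move=> fx; apply: contrapT => nAx; have := fd x _ nAx; rewrite (deq x x).2 // leNgt fx.
move=> Ax; have /dN[e e0 eA] : nbhs x A by apply: open_nbhs_nbhs.
apply: (@lt_le_trans _ _ (Num.min 1 e)); first by rewrite lt_min ltr01.
apply: lb_le_inf; first by exists 1.
move=> r [->|[y Ay ->]]; first by rewrite ge_min lexx.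
rewrite ge_min; apply/orP; right; rewrite leNgt; apply/negP => xy.
exact: Ay (eA y xy).
Qed.

End DistanceFunction.

Section CoveringDimension.

(** For P = [within U] this expresses D(U) <= n. The families are indexed and repetitions count, so
    that preimages and products of families need no care about coinciding members. *)
Definition dim_le (X : topologicalType) (P : set X -> Prop) (n : nat) :=
  exists (I : finType) (f : I -> set X),
    [/\ forall i, open (f i), forall i, P (f i), forall x, exists i, f i x &
     forall x, (#|[set i | x \in f i]%SET| <= n.+1)%N].

Definition within (X : Type) (U : set (set X)) (E : set X) : Prop :=
  exists2 B, U B & E `<=` B.

Lemma dim_leT (X : topologicalType) (P : set X -> Prop) : P setT -> dim_le P 0.
Proof.
move=> PT; exists unit, (fun=> setT); split => [_|_|x|x].
- exact: openT.
- exact: PT.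
- by exists tt.
- by rewrite (leq_trans (max_card _)) // card_unit.
Qed.

Lemma dim_le_preimage (X Z : topologicalType) (h : X -> Z) P Q n :
  continuous h -> (forall E, P E -> Q (h @^-1` E)) -> dim_le P n -> dim_le Q n.
Proof.
move=> hc PQ [I [f [fo fP fc fn]]].
exists I, (fun i => h @^-1` f i); split => [i|i|x|x].
- by move/continuousP : hc; exact.
- exact: PQ.
- by have [i ?] := fc (h x); exists i.
- apply: leq_trans (fn (h x)); apply: subset_leq_card; apply/fintype.subsetP => i.
  by rewrite !inE.
Qed.

(* Lindenstrauss-Weiss subadditivity. The two families give points of two
   simplices; cutting [0, 1] at the cumulative sums of both sets of barycentric
   coordinates is the staircase triangulation of the product of the simplices. *)
Lemma dim_leI (R : realType) (X : topologicalType) (P Q S : set X -> Prop) n k :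
  metrizable R X ->
  (forall A B E, P A -> Q B -> E `<=` A -> E `<=` B -> S E) ->
  dim_le P n -> dim_le Q k -> dim_le S (n + k).
Proof.
move=> mX PQS [I [f [fo fP fc fn]]] [J [g [go gQ gc gn]]].
have [w wP] := choice (fun i => metrizable_open_fun mX (fo i)).
have [z zP] := choice (fun j => metrizable_open_fun mX (go j)).
pose cum (T : finType) (h : T -> X -> R) (k : nat) (x : X) : R :=
  \sum_(i < #|T| | (i < k)%N) h (enum_val i) x.
have cum_cont (T : finType) (h : T -> X -> R) l : (forall i, continuous (h i)) -> continuous (cum T h l).
  move=> hc; rewrite /cum.
  have -> : (fun x => \sum_(i < #|T| | (i < l)%N) h (enum_val i) x) =
      (fun x => \sum_(i < #|T|) (if (i < l)%N then h (enum_val i) x else 0)).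
    by apply/funext => x; rewrite big_mkcond.
  elim: (index_enum _) => [|i r IH].
    by under eq_fun do rewrite big_nil; move=> x; exact: cvg_cst.
  under eq_fun do rewrite big_cons.
  move=> x; apply: cvgD; last exact: IH.
  by case: ifP => _; [exact: hc|exact: cvg_cst].
have cumS (T : finType) (h : T -> X -> R) (i : 'I_#|T|) x :
    cum T h i.+1 x = cum T h i x + h (enum_val i) x.
  rewrite /cum (bigD1 i) //= addrC; congr (_ + _); apply: eq_bigl => j.
  by rewrite ltnS -val_eqE /= ltn_neqAle andbC.
have cum0 (T : finType) (h : T -> X -> R) x : cum T h 0 x = 0 by rewrite /cum big_pred0.
have cum_homo (T : finType) (h : T -> X -> R) x : (forall i, 0 <= h i x) ->
    {homo cum T h ^~ x : i j / (i <= j)%N >-> i <= j}.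
  move=> h0 a b ab; rewrite /cum [leLHS]big_mkcond [leRHS]big_mkcond /=.
  apply: ler_sum => i _; case: ifP => // ia; last by case: ifP.
  by rewrite (leq_trans ia).
have cum_tot (T : finType) (h : T -> X -> R) i x : (forall i, 0 <= h i x) -> 0 < h i x ->
    0 < cum T h #|T| x.
  move=> h0 hi; apply: lt_le_trans (_ : cum T h (enum_rank i).+1 x <= _).
    rewrite cumS enum_rankK; apply: lt_le_trans hi _; rewrite lerDr.
    by rewrite -(cum0 T h x); exact: cum_homo.
  exact: cum_homo.
(* Multiplying each family by the total of the other replaces normalisation to [0, 1]: both
   staircases end at the product of the totals. *)
pose u x l := cum I w l x * cum J z #|J| x.
pose v x l := cum J z l x * cum I w #|I| x.
have w0 i x : 0 <= w i x by case: (wP i).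
have z0 j x : 0 <= z j x by case: (zP j).
have cI x : 0 < cum I w #|I| x.
  by have [i fi] := fc x; apply: (@cum_tot _ _ i) => //; case: (wP i) => _ _ /(_ x)[_]; exact.
have cJ x : 0 < cum J z #|J| x.
  by have [i fi] := gc x; apply: (@cum_tot _ _ i) => //; case: (zP i) => _ _ /(_ x)[_]; exact.
have uS x (i : 'I_#|I|) : (u x i < u x i.+1) = (x \in f (enum_val i)).
  rewrite /u ltr_pM2r // cumS ltrDl; apply/idP/idP; rewrite in_setE.
    by case: (wP (enum_val i)) => _ _ /(_ x)[]; auto.
  by case: (wP (enum_val i)) => _ _ /(_ x)[]; auto.
have vS x (i : 'I_#|J|) : (v x i < v x i.+1) = (x \in g (enum_val i)).
  rewrite /v ltr_pM2r // cumS ltrDl; apply/idP/idP; rewrite in_setE.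
    by case: (zP (enum_val i)) => _ _ /(_ x)[]; auto.
  by case: (zP (enum_val i)) => _ _ /(_ x)[]; auto.
have uh x : {homo u x : i j / (i <= j)%N >-> i <= j}.
  by move=> a b ab; rewrite ler_pM2r //; exact: cum_homo.
have vh x : {homo v x : i j / (i <= j)%N >-> i <= j}.
  by move=> a b ab; rewrite ler_pM2r //; exact: cum_homo.
have u0 x : u x 0 = 0 by rewrite /u cum0 mul0r.
have v0 x : v x 0 = 0 by rewrite /v cum0 mul0r.
have uv x : u x #|I| = v x #|J| by rewrite /u /v mulrC.
have um x : 0 < u x #|I| by rewrite mulr_gt0.
have uc l : continuous (u ^~ l).
  move=> x; apply: cvgM; apply: cum_cont => i; by [case: (wP i)|case: (zP i)].
have vc l : continuous (v ^~ l).
  move=> x; apply: cvgM; apply: cum_cont => i; by [case: (wP i)|case: (zP i)].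
have lt_open (a b : X -> R) : continuous a -> continuous b -> open [set x | a x < b x].
  move=> ac bc; have -> : [set x | a x < b x] = (fun x => b x - a x) @^-1` [set r | 0 < r].
    by apply/seteqP; split => x /=; rewrite subr_gt0.
  apply: open_comp; last exact: open_gt.
  by move=> x _; apply: cvgB; [exact: bc|exact: ac].
(* Interval i of u is nondegenerate exactly at the points of the i-th member of f, and likewise for
   v and g, so each new member lies in an intersection of an old member of f and one of g. *)
exists ('I_#|I| * 'I_#|J|)%type, (fun ij : 'I_#|I| * 'I_#|J| => [set x | overlap (u x) (v x) ij.1 ij.2]).
split => [[i j]|[i j]|x|x] /=.
- have -> : [set x | overlap (u x) (v x) i j] =
     [set x | u x i < u x i.+1] `&` [set x | v x j < v x j.+1]
     `&` [set x | u x i < v x j.+1] `&` [set x | v x j < u x i.+1].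
    apply/seteqP; split => x /=; first by move=> /and4P[].
    by move=> [[[? ?] ?] ?]; apply/and4P.
  by do 3?apply: openI; apply: lt_open.
- apply: (PQS (f (enum_val i)) (g (enum_val j))) => // x /= /and4P[];
    by rewrite uS vS !in_setE.
- by have [i [j ij]] := overlap_exists (u0 x) (v0 x) (uv x) (um x); exists (i, j).
(* Overlapping pairs are strictly fewer than (n + 1) + (k + 1), hence at most (n + k) + 1. *)
- have /= := card_overlap (uh x) (vh x) (v0 x) (uv x) (um x).
  have -> : #|[set i : 'I_#|I| | (u x i < u x i.+1)%R]%SET| = #|[set i | x \in f i]%SET|.
    rewrite -(card_imset _ (@enum_val_inj I I)); apply: eq_card => i.
    rewrite [RHS]finset.in_set; apply/imsetP/idP => [[j]|xi]; first by rewrite finset.in_set (uS x j) => ? ->.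
    by exists (enum_rank i); rewrite ?enum_rankK // finset.in_set (uS x (enum_rank i)) enum_rankK.
  have -> : #|[set i : 'I_#|J| | (v x i < v x i.+1)%R]%SET| = #|[set i | x \in g i]%SET|.
    rewrite -(card_imset _ (@enum_val_inj J J)); apply: eq_card => i.
    rewrite [RHS]finset.in_set; apply/imsetP/idP => [[j]|xi]; first by rewrite finset.in_set (vS x j) => ? ->.
    by exists (enum_rank i); rewrite ?enum_rankK // finset.in_set (vS x (enum_rank i)) enum_rankK.
  have -> : #|[set ij : 'I_#|I| * 'I_#|J| |
       x \in [set y | overlap (u y) (v y) ij.1 ij.2]%classic]%SET| =
    #|[set ij : 'I_#|I| * 'I_#|J| | overlap (u x) (v x) ij.1 ij.2]%SET|.
    by apply: eq_card => ij; rewrite !finset.in_set; apply/idP/idP; rewrite in_setE.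
  by move=> /leq_trans/(_ (leq_add (fn x) (gn x))); rewrite addSn addnS ltnS.
Qed.

End CoveringDimension.

(** * The cover dimension as a natural number *)

Section CoverDimension.

(** The default 0 does not arise for P = [within U] with U a finite open cover of a nonempty
    space. *)
Definition dim_num (X : topologicalType) (P : set X -> Prop) : nat :=
  if pselect (exists n, `[< dim_le P n >]) is left h then ex_minn h else 0.

Lemma dim_numP (X : topologicalType) (P : set X -> Prop) n :
  dim_le P n -> dim_le P (dim_num P) /\ (dim_num P <= n)%N.
Proof.
move=> Pn; rewrite /dim_num; case: pselect => [h|[]]; last by exists n; apply/asboolP.
by case: ex_minnP => k /asboolP kP kmin; split => //; apply: kmin; apply/asboolP.
Qed.

Lemma dim_num_mono (X Z : topologicalType) (P : set X -> Prop) (Q : set Z -> Prop) n :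
  dim_le Q n -> (forall k, dim_le Q k -> dim_le P k) -> (dim_num P <= dim_num Q)%N.
Proof. by move=> /dim_numP[Qn _] QP; have /dim_numP[] := QP _ Qn. Qed.

Context (R : realType) {X : topologicalType}.
Implicit Types (U V W : set (set X)) (x : X).

Lemma sum_indic W x : finite_set W ->
  \sum_(A \in W) (\1_A x : R) = (count (fun A : set X => x \in A) (fset_set W))%:R.
Proof.
move=> fW; rewrite fsbig_finite //= -sum1_count natr_sum big_mkcond /=.
by rewrite [RHS]big_mkcond /=; apply: eq_bigr => A _; rewrite indicE; case: (x \in A).
Qed.

(** Multiplicities are integers bounded by the number of members, so the supremum is a maximum; it
    is positive because W covers the point x. *)
Lemma cover_ord_attained W x : finite_open_cover W ->
  exists2 x1, (forall y, count (fun A : set X => y \in A) (fset_set W) <=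
                count (fun A : set X => x1 \in A) (fset_set W))%N &
    (cover_ord R W + 1 = (count (fun A : set X => x1 \in A) (fset_set W))%:R)
    /\ (0 < count (fun A : set X => x1 \in A) (fset_set W))%N.
Proof.
move=> [fW oW cW]; set cnt := fun y : X => count (fun A : set X => y \in A) (fset_set W).
have exP : exists n, `[< exists y, cnt y = n >] by exists (cnt x); apply/asboolP; exists x.
have ubP n : `[< exists y, cnt y = n >] -> (n <= size (fset_set W))%N.
  by move=> /asboolP[y <-]; exact: count_size.
have [n /asboolP[x1 x1n] nmax] := ex_maxnP exP ubP.
have cmax y : (cnt y <= cnt x1)%N by rewrite x1n; apply: nmax; apply/asboolP; exists y.
exists x1 => //; split; last first.
  have [A WA Ax] : (\bigcup_(A in W) A) x1 by rewrite cW.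
  by rewrite -has_count; apply/hasP; exists A; [rewrite in_fset_set // inE|rewrite inE].
rewrite /cover_ord subrK.
have ubE : ubound (range (fun x => \sum_(A \in W) (\1_A x : R))) (cnt x1)%:R.
  by move=> _ [y _ <-]; rewrite sum_indic // ler_nat cmax.
have E1 : range (fun x => \sum_(A \in W) (\1_A x : R)) (cnt x1)%:R.
  by exists x1 => //; rewrite sum_indic.
apply/eqP; rewrite eq_le; apply/andP; split.
  by apply: ge_sup => //; exists (cnt x1)%:R.
by apply: ub_le_sup => //; exists (cnt x1)%:R.
Qed.

Lemma cover_ord_dim_le U W x : finite_open_cover W -> refines W U ->
  exists2 n, cover_ord R W = n%:R & dim_le (within U) n.
Proof.
move=> fW WU; have [x1 cmax [oE c0]] := cover_ord_attained x fW.
have [finW oW cW] := fW; set s := fset_set W in cmax oE c0.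
exists (count (fun A : set X => x1 \in A) s).-1.
  by apply: (addIr 1); rewrite oE natr1 prednK.
exists 'I_(size s), (fun i : 'I_(size s) => nth set0 s i); split.
- move=> i; apply: oW; have : nth set0 s i \in s by exact: mem_nth.
  by rewrite in_fset_set // inE.
- move=> i; apply: WU; have : nth set0 s i \in s by exact: mem_nth.
  by rewrite in_fset_set // inE.
- move=> y; have [A WA Ay] : (\bigcup_(A in W) A) y by rewrite cW.
  have As : A \in (s : seq _) by rewrite in_fset_set // inE.
  have lt : (index A s < size s)%N by rewrite index_mem.
  by exists (Ordinal lt); rewrite /= nth_index.
- move=> y; rewrite prednK //; apply: leq_trans (cmax y).
  rewrite -sum1_count (big_nth set0) big_mkord sum1_card; apply: subset_leq_card.
  by apply/fintype.subsetP => i; rewrite finset.in_set.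
Qed.

(** Passing from the family to its range merges equal members, so multiplicities can only drop. *)
Lemma dim_le_cover_ord U n x : dim_le (within U) n ->
  exists W, [/\ finite_open_cover W, refines W U & cover_ord R W <= n%:R].
Proof.
move=> [I [f [fo fP fc fn]]]; exists (range f).
have fW : finite_open_cover (range f).
  split => [|A [i _ <-]|].
  - exact/finite_image/finite_finset.
  - exact: fo.
  - by apply/seteqP; split => // y _; have [i fi] := fc y; exists (f i).
split => //; first by move=> A [i _ <-]; exact: fP.
have [x1 _ [oE _]] := cover_ord_attained x fW.
rewrite -(lerD2r 1) oE natr1 ler_nat; apply: leq_trans (fn x1).
rewrite -size_filter cardE -(size_map f); apply: uniq_leq_size.
  exact/filter_uniq/fset_uniq.
move=> A; rewrite mem_filter in_fset_set; last exact/finite_image/finite_finset.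
move=> /andP[xA]; rewrite inE => -[i _ fiA]; apply/mapP; exists i => //.
by rewrite mem_enum finset.in_set fiA.
Qed.

Lemma finite_open_cover_dim_le U x : finite_open_cover U -> exists n, dim_le (within U) n.
Proof.
move=> fU; have [|n _ ?] := cover_ord_dim_le x fU (U := U); last by exists n.
by move=> A UA; exists A.
Qed.

Lemma cover_dimE U x : finite_open_cover U ->
  cover_dim R U = (dim_num (within U))%:R.
Proof.
move=> fU; have [n0 /dim_numP[dU _]] := finite_open_cover_dim_le x fU.
have [W [fW WU oW]] := dim_le_cover_ord x dU.
have lbE : lbound [set cover_ord R W | W in [set W | finite_open_cover W /\ refines W U]]
    (dim_num (within U))%:R.
  move=> _ [W' [fW' WU'] <-]; have [n -> /dim_numP[_ h]] := cover_ord_dim_le x fW' WU'.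
  by rewrite ler_nat.
apply/eqP; rewrite eq_le; apply/andP; split.
  by apply: le_trans oW; apply: ge_inf; [exists (dim_num (within U))%:R|exists W].
by apply: lb_le_inf => //; exists (cover_ord R W); exists W.
Qed.

End CoverDimension.

(** * Joins, preimages and products of finite open covers *)

Section Covers.

Lemma finite_open_coverT (X : topologicalType) : finite_open_cover [set [set: X]].
Proof.
split; [exact: finite_set1|by move=> A ->; exact: openT|].
by apply/seteqP; split => // x _; exists setT.
Qed.

Lemma finite_open_cover_preimage (X Z : topologicalType) (h : X -> Z) U :
  continuous h -> finite_open_cover U -> finite_open_cover [set h @^-1` A | A in U].
Proof.
move=> hc [fU oU cU]; split.
- exact: finite_image.
- by move=> _ [A UA <-]; move/continuousP : hc; apply; exact: oU.
- apply/seteqP; split => // x _; have [A UA Ax] : (\bigcup_(A in U) A) (h x) by rewrite cU.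
  by exists (h @^-1` A) => //; exists A.
Qed.

Lemma finite_open_cover_join (X : topologicalType) (U V : set (set X)) :
  finite_open_cover U -> finite_open_cover V -> finite_open_cover (cover_join U V).
Proof.
move=> [fU oU cU] [fV oV cV]; split.
- exact: finite_image2.
- by move=> _ [A UA [B VB <-]]; apply: openI; [exact: oU|exact: oV].
- apply/seteqP; split => // x _; have [A UA Ax] : (\bigcup_(A in U) A) x by rewrite cU.
  have [B VB Bx] : (\bigcup_(B in V) B) x by rewrite cV.
  by exists (A `&` B) => //; exists A => //; exists B.
Qed.

Lemma within_join (X : Type) (U V : set (set X)) E :
  within (cover_join U V) E <-> within U E /\ within V E.
Proof.
split=> [[_ [A UA [B VB <-]]]|[[A UA EA] [B VB EB]]].
  by rewrite subsetI => -[EA EB]; split; [exists A|exists B].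
by exists (A `&` B); [exists A => //; exists B|rewrite subsetI].
Qed.

Lemma finite_open_cover_bigjoin (I : Type) (X Z : topologicalType) (h : I -> X -> Z)
    (l : seq I) U : (forall i, continuous (h i)) -> finite_open_cover U ->
  finite_open_cover
    (\big[@cover_join X/[set setT]]_(i <- l) [set h i @^-1` A | A in U]).
Proof.
move=> hc fU; elim/big_ind : _ => [||i _]; first exact: finite_open_coverT.
  exact: finite_open_cover_join.
exact: finite_open_cover_preimage.
Qed.

Lemma within_bigjoin (I : eqType) (X Z : Type) (h : I -> X -> Z) (l : seq I) U E :
  within (\big[@cover_join X/[set setT]]_(i <- l) [set h i @^-1` A | A in U]) E <->
  forall i, i \in l -> exists2 B, U B & E `<=` h i @^-1` B.
Proof.
elim: l => [|i l IH]; first by rewrite big_nil; split => // _; exists setT.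
rewrite big_cons within_join IH; split=> [[[_ [B UB <-] EB] El] j|El].
  by rewrite inE => /orP[/eqP->|/El//]; exists B.
split; last by move=> j jl; apply: El; rewrite inE jl orbT.
have [B UB EB] := El i (mem_head _ _).
by exists (h i @^-1` B) => //; exists B.
Qed.

(** The near-covering form of compactness is applied to the filter of finite lists of points
    directed by inclusion. *)
Lemma finite_subcover (X : topologicalType) (O : X -> set X) :
  compact [set: X] -> (forall x, open (O x)) -> (forall x, O x x) ->
  exists s : seq X, forall x, exists2 y, y \in s & O y x.
Proof.
move=> /compact_near_coveringP cX oO xO.
pose F : set_system (seq X) := fun S => exists s0 : seq X, forall s : seq X, {subset s0 <= s} -> S s.
have FF : Filter F.
  split; first by exists [::].
    move=> P Q [s hs] [t ht]; exists (s ++ t) => u su; split; [apply: hs|apply: ht];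
      by move=> x xs; apply: su; rewrite mem_cat xs ?orbT.
  by move=> P Q PQ [s hs]; exists s => u /hs/PQ.
have [|s /(_ s)] := cX _ F (fun s x => exists2 y, y \in s & O y x) FF.
  move=> x _; exists (O x, [set s : seq X | x \in s]).
    split => /=; first exact: open_nbhs_nbhs.
    by exists [:: x] => s; apply; rewrite mem_head.
  by move=> [y s] /= [Oxy xs]; exists x.
by move=> h; exists s => x; apply: h.
Qed.

Lemma open_bigcap_seq (I : eqType) (X : topologicalType) (f : I -> set X) (s : seq I) :
  (forall i, open (f i)) -> open [set x | forall i, i \in s -> f i x].
Proof.
move=> fo; elim: s => [|i s IH].
  by rewrite (_ : mkset _ = setT); [exact: openT|apply/seteqP; split].
rewrite (_ : mkset _ = f i `&` [set x | forall i, i \in s -> f i x]); first exact: openI.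
apply/seteqP; split => [x h|x [fx h] j].
  by split => [|j js]; apply: h; rewrite inE ?eqxx ?js ?orbT.
by rewrite inE => /orP[/eqP->|/h].
Qed.

Lemma finite_open_cover_seq (X : topologicalType) (I : eqType) (O : I -> set X) (s : seq I) :
  (forall i, open (O i)) -> (forall x, exists2 i, i \in s & O i x) ->
  finite_open_cover [set O i | i in [set` s]].
Proof.
move=> oO cO; split; [exact/finite_image/finite_seq|by move=> _ [i _ <-]|].
by apply/seteqP; split => // x _; have [i si Oi] := cO x; exists (O i) => //; exists i.
Qed.

(** A tube lemma argument: a fixed pair of covers V, W works for all products A x B at once. With m
    the multiplication of a group, it makes W fine after translation by any element. *)
Lemma product_refinement (Z G X : topologicalType) (m : Z * G -> X) (U : set (set X)) :
  compact [set: Z] -> compact [set: G] -> continuous m -> finite_open_cover U ->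
  exists (V : set (set Z)) (W : set (set G)),
    [/\ finite_open_cover V, finite_open_cover W &
     forall A B, V A -> W B -> exists2 C, U C & forall z g, A z -> B g -> C (m (z, g))].
Proof.
move=> cZ cG mc [fU oU cU].
have /choice[PQ PQP] : forall p : Z * G, exists PQ : set Z * set G,
    [/\ open PQ.1, open PQ.2, PQ.1 p.1, PQ.2 p.2 &
     exists2 C, U C & forall z g, PQ.1 z -> PQ.2 g -> C (m (z, g))].
  move=> [z g]; have [C UC Cm] : (\bigcup_(A in U) A) (m (z, g)) by rewrite cU.
  have : nbhs (z, g) (m @^-1` C) by apply: mc; apply: open_nbhs_nbhs; split => //; exact: oU.
  move=> [[P Q] /= [Pz Qg] PQC]; exists (P^°, Q^°); split => /=.
  - exact: open_interior.
  - exact: open_interior.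
  - by [].
  - by [].
  - exists C => // z' g' Pz' Qg'; apply: (PQC (z', g')).
    by split; exact: interior_subset.
pose P g z := (PQ (z, g)).1; pose Q g z := (PQ (z, g)).2.
have /choice[sg sgP] : forall g, exists s : seq Z, forall z, exists2 y, y \in s & P g y z.
  by move=> g; apply: finite_subcover => // z; case: (PQP (z, g)).
(* Finitely many boxes cover the slice Z x {g}; [O g] is their common width. *)
pose O g := [set g' | forall z, z \in sg g -> Q g z g'].
have oO g : open (O g) by apply: open_bigcap_seq => z; case: (PQP (z, g)).
have [t tP] : exists s : seq G, forall x, exists2 y, y \in s & O y x.
  by apply: finite_subcover => // g z _; case: (PQP (z, g)).
(* For each of the finitely many tubes in [t], one box above z is selected; [N z] lies in the bases
   of all of them. *)
have /choice[pick pickP] : forall zg : Z * G, exists y, y \in sg zg.2 /\ P zg.2 y zg.1.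
  by move=> [z g]; have [y ys Py] := sgP g z; exists y.
pose N z := [set z' | forall g, g \in t -> P g (pick (z, g)) z'].
have oN z : open (N z) by apply: open_bigcap_seq => g; case: (PQP (pick (z, g), g)).
have [r rP] : exists s : seq Z, forall x, exists2 y, y \in s & N y x.
  by apply: finite_subcover => // z g _; case: (pickP (z, g)).
exists [set N z | z in [set` r]], [set O g | g in [set` t]]; split.
- exact: finite_open_cover_seq.
- exact: finite_open_cover_seq.
- move=> _ _ [z _ <-] [g gt <-].
  have [_ _ _ _ [C UC hC]] := PQP (pick (z, g), g).
  exists C => // z' g' Nz' Og'; apply: hC; first exact: Nz'.
  by apply: Og'; case: (pickP (z, g)).
Qed.

Lemma metrizable_prod (R : realType) (Y G : topologicalType) :
  metrizable R Y -> metrizable R G -> metrizable R (Y * G)%type.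
Proof.
move=> [d [d0 deq dC dT dN]] [d' [d'0 d'eq d'C d'T d'N]].
exists (fun p q => d p.1 q.1 + d' p.2 q.2); split.
- by move=> p q; exact: addr_ge0.
- move=> [y g] [y' g'] /=; split=> [/eqP|[-> ->]].
    by rewrite paddr_eq0 // => /andP[/eqP/deq-> /eqP/d'eq->].
  by rewrite (deq _ _).2 // (d'eq _ _).2 // addr0.
- by move=> p q; rewrite dC d'C.
- by move=> p q s; rewrite addrACA; exact: lerD.
- move=> [y g] A; split=> [[[P Q] /= [/dN[e e0 eP] /d'N[e' e'0 e'Q]] PQA]|[e e0 eA]].
    exists (Num.min e e'); first by rewrite lt_min e0.
    move=> [y' g'] /=; rewrite lt_min => /andP[h h']; apply: (PQA (y', g')); split => /=.
      by apply: eP => /=; apply: le_lt_trans h; rewrite lerDl.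
    by apply: e'Q => /=; apply: le_lt_trans h'; rewrite lerDr.
  exists ([set y' | d y y' < e / 2], [set g' | d' g g' < e / 2]) => /=.
    by split; [apply/dN|apply/d'N]; exists (e / 2) => //; rewrite divr_gt0.
  move=> [y' g'] /= [h h']; apply: eA => /=; lra.
Qed.

End Covers.

(** * Mean dimension of skew products *)

Section SystemDimension.
Context (R : realType) {Gamma : groupType} {X : topologicalType}.
Variable act : Gamma -> X -> X.
Hypotheses (x0 : X) (mX : metrizable R X) (act_action : is_action act).
Hypothesis act_cont : forall s, continuous (act s).
Implicit Types (U : set (set X)) (F A B : {fset Gamma}).

Definition pull_dim U F : nat := dim_num (within (cover_pull act U F)).

Lemma finite_open_cover_pull U F :
  finite_open_cover U -> finite_open_cover (cover_pull act U F).
Proof. exact: finite_open_cover_bigjoin. Qed.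

Lemma within_pull U F E : within (cover_pull act U F) E <->
  forall s, s \in F -> exists2 B, U B & E `<=` act s @^-1` B.
Proof. exact: within_bigjoin. Qed.

Lemma pull_dimP U F : finite_open_cover U ->
  dim_le (within (cover_pull act U F)) (pull_dim U F).
Proof.
move=> /(finite_open_cover_pull F)/(finite_open_cover_dim_le R x0)[n].
by move=> /dim_numP[].
Qed.

Lemma pull_dim0 U : pull_dim U fset0 = 0%N.
Proof.
have /dim_numP[_] : dim_le (within (cover_pull act U fset0)) 0.
  by apply/dim_leT/within_pull => s; rewrite inE.
by rewrite leqn0 => /eqP.
Qed.

Lemma pull_dimU U A B : finite_open_cover U ->
  (pull_dim U (A `|` B)%fset <= pull_dim U A + pull_dim U B)%N.
Proof.
move=> fU; suff /dim_numP[] : dim_le (within (cover_pull act U (A `|` B)%fset))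
  (pull_dim U A + pull_dim U B) by [].
apply: dim_leI mX _ (pull_dimP A fU) (pull_dimP B fU) => E1 E2 E.
move=> /within_pull EA /within_pull EB EE1 EE2; apply/within_pull => s.
rewrite in_fsetU => /orP[/EA[C UC h]|/EB[C UC h]]; exists C => //.
  exact: subset_trans EE1 h.
exact: subset_trans EE2 h.
Qed.

Lemma pull_dim_translate U A c : finite_open_cover U ->
  (pull_dim U (translate A c) <= pull_dim U A)%N.
Proof.
move=> fU; apply: (dim_num_mono (pull_dimP A fU)) => k dk.
apply: (dim_le_preimage (@act_cont c) _ dk) => E /within_pull EA; apply/within_pull.
move=> _ /translateP[t tA ->]; have [C UC EC] := EA t tA; exists C => // x Ex /=.
by rewrite act_action.2; exact: EC.
Qed.

Lemma pull_dim_card U A : finite_open_cover U ->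
  (pull_dim U A <= #|` A| * pull_dim U [fset 1%g]%fset)%N.
Proof.
move=> fU; apply: subadditive_card; first exact: pull_dim0.
  by move=> ? ?; exact: pull_dimU.
by move=> ? ?; exact: pull_dim_translate.
Qed.

(** Ornstein-Weiss applies to [pull_dim U], so the [lim] in [mdim] is the value of a genuine
    limit. *)
Lemma pull_dim_cvg U : amenable R Gamma -> finite_open_cover U ->
  exists l : R, [/\ 0 <= l,
    (pull_dim U F)%:R / #|` F|%:R @[F --> folner_filter R Gamma] --> l,
    lim (cover_dim R (cover_pull act U F) / #|` F|%:R
           @[F --> folner_filter R Gamma]) = l &
    (l%:E <= mdim R act)%E].
Proof.
move=> ham fU; have PF := folner_filter_proper ham.
have [l l0 cl] : exists2 l : R, 0 <= l &
    (pull_dim U F)%:R / #|` F|%:R @[F --> folner_filter R Gamma] --> l.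
  apply: ornstein_weiss ham; first exact: pull_dim0.
    by move=> ? ?; exact: pull_dimU.
  by move=> ? ?; exact: pull_dim_translate.
have limE : lim (cover_dim R (cover_pull act U F) / #|` F|%:R
           @[F --> folner_filter R Gamma]) = l.
  have -> : (fun F => cover_dim R (cover_pull act U F) / #|` F|%:R) =
      (fun F => (pull_dim U F)%:R / #|` F|%:R).
    by apply/funext => F; rewrite (cover_dimE R x0) //; exact: finite_open_cover_pull.
  exact: cvg_lim cl.
exists l; split => //; apply: ereal_sup_ubound; exists U => //; by rewrite limE.
Qed.

End SystemDimension.

(** The lower limit is the supremum of the infima over tails, so every tail has infimum below l. *)
Lemma limn_einf_frequently (R : realType) (u : (\bar R)^nat) (l : \bar R) N :
  (limn_einf u < l)%E -> exists2 n, (N <= n)%N & (u n < l)%E.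
Proof.
rewrite limn_einf_lim (cvg_lim _ (@cvg_einfs_sup _ u)) // => h.
have /ereal_inf_lt[_ /= [n Nn <-] un] : (einfs u N < l)%E.
  by apply: le_lt_trans h; apply: ereal_sup_ubound; exists N.
by exists n.
Qed.

Lemma dynamical_system_continuous (R : realType) (Gamma : groupType)
    (X : topologicalType) (act : Gamma -> X -> X) s :
  dynamical_system R act -> continuous (act s).
Proof.
move=> [_ _ _ _ hc] x.
apply: (@continuous2_cvg _ (discrete_topology Gamma) _ _ _ _
  (fun=> s) id act s x); [exact: (hc (s, x))|exact: cvg_cst|exact: cvg_id].
Qed.

(** * Covers of the skew product and of its fibres *)

Section SkewProduct.
Context (R : realType) {Gamma : groupType} {Y : topologicalType}.
Context {G : topologicalGroupType}.
Variables (a : Gamma -> Y -> Y) (b : Gamma -> G -> G) (sigma : Gamma -> Y -> G).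
Hypotheses (ha : dynamical_system R a) (hb : algebraic_action R b).
Hypothesis hsigma : continuous_cocycle a b sigma.
Let act := skew_action a b sigma.

Let a_cont s : continuous (a s). Proof. exact: dynamical_system_continuous ha. Qed.
Let b_cont s : continuous (b s).
Proof. by case: hb => hb' _; exact: dynamical_system_continuous hb'. Qed.

Let sigma_cont s : continuous (sigma s).
Proof.
move=> x; apply: (@continuous2_cvg _ (discrete_topology Gamma) _ _ _ _
  (fun=> s) id sigma s x); [exact: (hsigma.1 (s, x))|exact: cvg_cst|exact: cvg_id].
Qed.

Let mulG_cvg (T : topologicalType) (f g : T -> G) :
  continuous f -> continuous g -> continuous (fun x => (f x * g x)%g).
Proof.
move=> fc gc x; apply: (@continuous2_cvg _ _ _ _ _ _ f g (fun u v => (u * v)%g)).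
- exact: (mulg_continuous (f x, g x)).
- exact: fc.
- exact: gc.
Qed.

Lemma skew_continuous s : continuous (act s).
Proof.
move=> p; apply: cvg_pair.
  apply: (@continuous_comp _ _ _ fst (a s)); [exact: cvg_fst|exact: a_cont].
apply: (@mulG_cvg _ (fun p => sigma s p.1) (fun p => b s p.2)) => {}p.
  apply: (@continuous_comp _ _ _ fst (sigma s)); [exact: cvg_fst|exact: sigma_cont].
apply: (@continuous_comp _ _ _ snd (b s)); [exact: cvg_snd|exact: b_cont].
Qed.

Lemma skew_is_action : is_action act.
Proof.
have [_ _ _ [a1 aM] _] := ha; have [[_ _ _ [b1 bM] _] bG] := hb.
have [_ coc] := hsigma.
split=> [[y g]|s t [y g]]; rewrite /act /skew_action /=.
  (* The cocycle identity at s = t = 1 makes sigma(1, y) idempotent, hence trivial. *)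
  have := coc 1%g 1%g y; rewrite mulg1 a1 b1 => /(congr1 (fun g => (sigma 1%g y)^-1 * g)%g).
  by rewrite mulVg mulKg => <-; rewrite b1 mul1g.
by rewrite aM coc bM bG mulgA.
Qed.

Lemma skew_metrizable : metrizable R (Y * G)%type.
Proof.
by case: ha => _ _ mY _ _; case: hb => -[_ _ mG _ _] _; exact: metrizable_prod.
Qed.

Lemma compact_prodT : compact [set: Y * G].
Proof.
case: ha => _ cY _ _ _; case: hb => -[_ cG _ _ _] _.
by rewrite -setXTT; exact: compact_setX.
Qed.

(* A left-translation-uniform refinement W' of W absorbs the cocycle, so that
   on the fibre over y the cover induced by W' refines the one of W on G. *)
Lemma pull_dim_fiber (W : set (set G)) : finite_open_cover W ->
  exists2 U : set (set (Y * G)), finite_open_cover U &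
    forall (y : Y) A, (pull_dim b W A)%:R <=
      cover_dim R (Defs.cover_restr (cover_pull act U A) (fst @^-1` [set y])).
Proof.
move=> fW; have cG : compact [set: G] by case: hb => -[].
have [N [W' [fN fW' NW']]] := product_refinement cG cG mulg_continuous fW.
exists [set snd @^-1` B | B in W'].
  by apply: finite_open_cover_preimage => // p; exact: cvg_snd.
move=> y A; set U := [set _ | _ in W']; set K := fst @^-1` [set y].
have fU : finite_open_cover U by apply: finite_open_cover_preimage => // p; exact: cvg_snd.
have yK g : (y, g) \in K by rewrite inE.
pose h (g : G) : K := exist _ (y, g) (yK g).
have hc : continuous h.
  apply: (@continuous_comp_initial K G (Y * G)%type set_val h) => g.
  by apply: cvg_pair; [exact: cvg_cst|exact: cvg_id].
have vc : continuous (@set_val _ K) by exact: initial_continuous.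
have fK : finite_open_cover (Defs.cover_restr (cover_pull act U A) K).
  apply: finite_open_cover_preimage => //; apply: finite_open_cover_pull => //.
  exact: skew_continuous.
rewrite (cover_dimE R (h 1%g) fK) ler_nat.
have [n dn] := finite_open_cover_dim_le R (h 1%g) fK.
apply: (dim_num_mono dn) => k dk; apply: (dim_le_preimage hc _ dk) => E [_ [B UB <-] EB].
apply/within_pull => s sA.
have /within_pull/(_ s sA)[_ [C W'C <-] BC] : within (cover_pull act U A) B by exists B.
(* The element s g is recovered as sigma(s, y)^-1 times the G-coordinate of s(y, g), which ranges
   over C. *)
have [M NM Ms] : (\bigcup_(M in N) M) (sigma s y)^-1%g by case: fN => _ _ ->.
have [D WD hD] := NW' _ _ NM W'C; exists D => // g Eg /=.
have := BC _ (EB _ Eg); rewrite /= => Cg.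
by have := hD _ _ Ms Cg; rewrite /= mulKg.
Qed.

(** If g' is the G-coordinate of cx and y that of x in Y, then tcx = (tcy, sigma(t, cy) (t g')). V
    locates (tcy, sigma(t, cy)) and the pullback of W^T by c locates t g'. W precedes [S] because
    the tiles will be chosen according to W. *)
Lemma pull_dim_skew (U : set (set (Y * G))) : finite_open_cover U ->
  exists2 W : set (set G), finite_open_cover W &
    forall S : seq {fset Gamma}, exists2 V : set (set Y), finite_open_cover V &
    forall A (L : seq ({fset Gamma} * Gamma)), (tiles_union L `<=` A)%fset ->
      (forall p, p \in L -> p.1 \in S /\ p.2 \in A) ->
      (pull_dim act U A <= pull_dim a V A + \sum_(p <- L) pull_dim b W p.1 +
         pull_dim act U (A `\` tiles_union L)%fset)%N.
Proof.
move=> fU; have cG : compact [set: G] by case: hb => -[].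
(* The first argument stands for the base point with the value of the cocycle, the second for the
   G-coordinate that it translates. *)
pose m (p : (Y * G) * G) : Y * G := (p.1.1, (p.1.2 * p.2)%g).
have mc : continuous m.
  move=> p; apply: cvg_pair.
    apply: (@continuous_comp _ _ _ fst fst); exact: cvg_fst.
  apply: (@mulG_cvg _ (fun p : (Y * G) * G => p.1.2) snd) => {}p; last exact: cvg_snd.
  apply: (@continuous_comp _ _ _ fst snd); [exact: cvg_fst|exact: cvg_snd].
have [N [W [fN fW NW]]] := product_refinement compact_prodT cG mc fU.
exists W => // S.
pose l := flatten [seq enum_fset T | T <- S].
pose V := \big[@cover_join Y/[set setT]]_(s <- l)
  [set (fun y => (a s y, sigma s y)) @^-1` B | B in N].
have [y0] : [set: Y] !=set0 by case: ha.
have mY : metrizable R Y by case: ha.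
have aA : is_action a by case: ha.
have fV : finite_open_cover V.
  apply: finite_open_cover_bigjoin => // s y.
  by apply: cvg_pair; [exact: a_cont|exact: sigma_cont].
exists V => // A L LA LP.
(* All centres of tiles belong to A, so V^A gives control at every centre simultaneously. *)
have dV : dim_le (fun E : set (Y * G) => forall s, s \in A ->
     exists2 B, V B & forall x, E x -> B (a s x.1)) (pull_dim a V A).
  apply: (dim_le_preimage (h := fst) _ _ (pull_dimP R y0 a_cont A fV)) => [|E].
    by move=> x; exact: cvg_fst.
  move=> /within_pull EA s /EA[B VB EB]; exists B => // x; exact: EB.
have dW : dim_le (fun E : set (Y * G) => forall p, p \in L -> forall s, s \in p.1 ->
     exists2 B, W B & forall x, E x -> B (b s (act p.2 x).2))
     (\sum_(p <- L) pull_dim b W p.1).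
  elim: (L) => [|[T c] L' IH].
    by rewrite big_nil; exact: dim_leT.
  have dT : dim_le (fun E : set (Y * G) => forall s, s \in T ->
     exists2 B, W B & forall x, E x -> B (b s (act c x).2)) (pull_dim b W T).
    have cc : continuous (fun x => (act c x).2).
      by move=> x; exact: (cvg_comp _ _ (@skew_continuous c x) cvg_snd).
    apply: (dim_le_preimage cc _ (pull_dimP R 1%g b_cont T fW)) => E.
    move=> /within_pull ET s /ET[B WB EB]; exists B => // x; exact: EB.
  rewrite big_cons; apply: dim_leI skew_metrizable _ dT IH => E1 E2 E h1 h2 EE1 EE2 q.
  rewrite inE => /orP[/eqP->|qL'] s sq.
    have [B WB hB] := h1 s sq; exists B => // x /EE1; exact: hB.
  have [B WB hB] := h2 q qL' s sq; exists B => // x /EE2; exact: hB.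
have dVW := dim_leI skew_metrizable (fun E1 E2 E (h1 : _ E1) (h2 : _ E2) (e1 : E `<=` E1)
  (e2 : E `<=` E2) => conj (ex_intro2 _ _ E1 h1 e1) (ex_intro2 _ _ E2 h2 e2)) dV dW.
have dU := pull_dimP R (y0, 1%g) skew_continuous (A `\` tiles_union L)%fset fU.
suff /dim_numP[] : dim_le (within (cover_pull act U A))
  (pull_dim a V A + \sum_(p <- L) pull_dim b W p.1 +
         pull_dim act U (A `\` tiles_union L)%fset) by [].
apply: dim_leI skew_metrizable _ dVW dU => E1 E2 E.
move=> [[EV hV E1V] [EW hW E1W]] /within_pull E2U EE1 EE2; apply/within_pull => s sA.
have [sL|sL] := boolP (s \in tiles_union L); last first.
  have [|C UC hC] := E2U s; first by rewrite in_fsetD sL.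
  by exists C => // x /EE2/hC.
have /bigfcupP[[T c] /andP[pL _] /= /translateP[t tT sE]] := sL.
have [/= TS cA] := LP _ pL.
have [B VB hB] := hV c cA.
have /within_bigjoin/(_ t)[|M NM BM] : within V B by exists B.
  by apply/flattenP; exists (enum_fset T) => //; apply: map_f.
have [D WD hD] := hW _ pL t tT.
have [C UC hC] := NW _ _ NM WD; exists C => // x Ex /=.
have Mx := BM _ (hB _ (E1V _ (EE1 _ Ex))).
have Dx := hD _ (E1W _ (EE1 _ Ex)).
by rewrite sE skew_is_action.2; exact: hC Mx Dx.
Qed.

End SkewProduct.

(** * The mean dimension inequality *)

Local Open Scope ereal_scope.

Theorem corollary3p3 (R : realType) (Gamma : groupType)
    (hcount : countable [set: Gamma]) (hamen : amenable R Gamma)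
    (F : nat -> {fset Gamma}) (hF : folner_sequence R F)
    (Y : topologicalType) (a : Gamma -> Y -> Y) (ha : dynamical_system R a)
    (G : topologicalGroupType) (b : Gamma -> G -> G)
    (hb : algebraic_action R b)
    (sigma : Gamma -> Y -> G) (hsigma : continuous_cocycle a b sigma) :
  mdim R (skew_action a b sigma) <=
    mdim R a +
    ereal_sup [set mdim_on R (skew_action a b sigma) F (fst @^-1` [set y])
              | y in [set: Y]].
Proof.
set act := skew_action a b sigma; set m := ereal_sup _.
have PF := folner_filter_proper hamen.
have [[y0 _] _ mY aA _] := ha.
have a_cont s : continuous (a s) by exact: dynamical_system_continuous ha.
have act_cont s : continuous (act s) by exact: (skew_continuous ha hb hsigma (s := s)).
have actA := skew_is_action ha hb hsigma.
have mX := skew_metrizable ha hb.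
(* The fibre over [y0] has lower limit below r, so infinitely many F_n satisfy the bound, and among
   these some are as invariant as desired. *)
have fibre_tiles (W : set (set G)) (r : R) : finite_open_cover W -> m < r%:E ->
    arbitrarily_invariant R [set T | ((pull_dim b W T)%:R <= r * #|` T|%:R)%R].
  move=> fW mr K delta K0 d0.
  have [U fU hU] := pull_dim_fiber ha hb hsigma fW.
  pose u n := (cover_dim R (Defs.cover_restr (cover_pull act U (F n)) (fst @^-1` [set y0]))
    / #|` F n|%:R)%R%:E.
  have ur : limn_einf u < r%:E.
    apply: le_lt_trans mr; apply: le_trans (_ : mdim_on R act F (fst @^-1` [set y0]) <= _).
      by apply: ereal_sup_ubound; exists U.
    by apply: ereal_sup_ubound; exists y0.
  have [N _ hN] := folner_sequence_almost_invariant K hF d0.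
  have [n Nn un] := limn_einf_frequently N ur.
  exists (F n); last exact: hN.
  have Fn0 : (0 < #|` F n|%:R :> R)%R by rewrite ltr0n cardfs_gt0; case: hF.
  rewrite /= -ler_pdivrMr //; move: un; rewrite /u lte_fin => /ltW; apply: le_trans.
  by rewrite ler_pM2r ?invr_gt0.
(* A negative m would yield a tile on which a natural number is bounded by a negative one. *)
have m0 : 0 <= m.
  rewrite leNgt; apply/negP => mneg.
  have [r mr r0] : exists2 r : R, m < r%:E & (r < 0)%R.
    have := mneg; case: (m) => [x| |] //; rewrite ?lte_fin => x0.
      by exists (x / 2)%R; rewrite ?lte_fin; lra.
    by exists (-1)%R; rewrite ?ltNyr //; lra.
  have K0 : [fset 1%g : Gamma]%fset != fset0 by apply/fset0Pn; exists 1%g; rewrite inE.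
  have [T /= hT [T0 _]] := fibre_tiles _ r (finite_open_coverT G) mr _ _ K0 ltr01.
  have T0' : (0 < #|` T|%:R :> R)%R by rewrite ltr0n cardfs_gt0.
  have : (0 <= r * #|` T|%:R)%R by apply: le_trans hT.
  by rewrite pmulr_lge0 // leNgt r0.
apply: ub_ereal_sup => _ [U fU <-].
have [lU [_ cU -> _]] := pull_dim_cvg (y0, 1%g) mX actA act_cont hamen fU.
case: (eqVneq m +oo) => [->|mfin].
  (* The sum is +oo only once [mdim R a] is known not to be -oo, which the trivial cover of Y
     shows. *)
  rewrite addey ?leey //.
  have [lV [lV0 _ _ lVm]] := pull_dim_cvg y0 mY aA a_cont hamen (finite_open_coverT Y).
  by rewrite gt_eqF // (lt_le_trans _ lVm) ?ltNyr.
have mE : m = (fine m)%:E by rewrite fineK // ge0_fin_numE // ltey.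
set r := fine m in mE.
have r0 : (0 <= r)%R by rewrite -lee_fin -mE.
rewrite mE; apply/lee_addgt0Pr => e e0.
have [W fW hW] := pull_dim_skew ha hb hsigma fU.
pose c0 := pull_dim act U [fset 1%g]%fset.
(* Four errors occur: the two limits along the Folner filter, the margin of the tiles above r, and
   the quasi-tiling. *)
have e4 : (0 < e / 4)%R by rewrite divr_gt0.
have tiles : arbitrarily_invariant R
    [set T | ((pull_dim b W T)%:R <= (r + e / 4) * #|` T|%:R)%R].
  by apply: fibre_tiles => //; rewrite mE lte_fin ltrDl.
have re0 : (0 <= r + e / 4)%R by lra.
have [S [K [delta [_ K0 d0 hS]]]] :=
  quasi_tiling_bound c0 tiles re0 (fun T h => h) e4.
have [V fV hV] := hW S.
have [lV [_ cV _ lVm]] := pull_dim_cvg y0 mY aA a_cont hamen fV.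
apply: (@le_trans _ _ (lV%:E + r%:E + e%:E)); last by rewrite leeD2r // leeD2r.
rewrite -!EFinD lee_fin.
(* The inequality does not involve A; amenability provides one A invariant enough for all the
   estimates. *)
suff : \forall A \near folner_filter R Gamma, (lU <= lV + r + e)%R.
  by move=> /filter_ex[].
have invA : \forall A \near folner_filter R Gamma, almost_invariant K delta A.
  by exists (K, delta).
have /cvgrPdist_le/(_ _ e4) nU := cU.
have /cvgrPdist_le/(_ _ e4) nV := cV.
near=> A.
have Ainv : almost_invariant K delta A by near: A.
have [A0 _] := Ainv.
have A0' : (0 < #|` A|%:R :> R)%R by rewrite ltr0n cardfs_gt0.
have : (`|lU - (pull_dim act U A)%:R / #|` A|%:R| <= e / 4)%R by near: A.
have : (`|lV - (pull_dim a V A)%:R / #|` A|%:R| <= e / 4)%R by near: A.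
rewrite !ler_norml => /andP[hV1 hV2] /andP[hU1 hU2].
have [L [LP LA Lb]] := hS A Ainv.
have : ((pull_dim act U A)%:R <= (pull_dim a V A)%:R + (r + e / 4 + e / 4) * #|` A|%:R)%R.
  apply: le_trans (_ : (pull_dim a V A)%:R + (\sum_(p <- L) pull_dim b W p.1 +
     #|` (A `\` tiles_union L)%fset| * c0)%N%:R <= _)%R; last by rewrite lerD2l.
  rewrite -natrD ler_nat addnA; apply: leq_trans (hV A L LA LP) _.
  by rewrite leq_add2l; exact: (pull_dim_card (y0, 1%g) mX actA act_cont).
rewrite -(ler_pM2r (_ : 0 < #|` A|%:R^-1)%R) ?invr_gt0 // mulrDl mulfK ?gt_eqF //.
move: hV1 hU2; lra.
Unshelve. all: by end_near. Qed.
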